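(* Let $\theta>0$, $h>0$, and let $H=L^2([0,h],\beta_{[0,h]},\lambda+\delta_{(h)})$. Let $\{\xi_t,\ t\in\mathbb{R}\}$ be the Ornstein-Uhlenbeck process with parameter $\theta$, and let $X_n(t)=\xi_{nh+t}$, $0\le t\le h$, $n\in\mathbb{Z}$. Then $X=\{X_n,\ n\in\mathbb{Z}\}$ defines the unique stationary solution, in the space $H$, to the equation $$X_n=\rho_\theta(X_{n-1})+\varepsilon_n,\quad n\in\mathbb{Z},$$ admitting the MAH($\infty$) representation $$X_n=\sum_{k=0}^{+\infty}\rho_\theta^k(\varepsilon_{n-k}),\quad n\in\mathbb{Z},\quad \rho_\theta\in\mathcal{L}(H).$$
   Context: $W=\{W_t,\ t\in\mathbb{R}\}$ is a standard bilateral (two-sided) Wiener process on a probability space $(\Omega,\mathcal{A},\mathcal{P})$. The Ornstein-Uhlenbeck (O.U.) process with parameter $\theta>0$ is the zero-mean Gaussian process with continuous sample paths $\xi_t=\int_{-\infty}^{t}e^{-\theta(t-s)}\,dW_s$, $t\in\mathbb{R}$. $\beta_{[0,h]}$ is the Borel $\sigma$-algebra of $[0,h]$, $\lambda$ is Lebesgue measure and $\delta_{(h)}$ is the Dirac measure at the point $h$. The norm of $H$ is $\|f\|_H=\sqrt{\int_0^h f(t)^2\,dt+f(h)^2}$; two functions are identified if and only if they agree Lebesgue-a.e. and at the point $h$. $\mathcal{L}(H)$ is the space of bounded linear operators on $H$. The operator $\rho_\theta$ on $H$ is $\rho_\theta(x)(t)=e^{-\theta t}x(h)$, and the innovations are $\varepsilon_n(t)=\int_{nh}^{nh+t}e^{-\theta(nh+t-s)}\,dW_s$,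 for $0\le t\le h$, $n\in\mathbb{Z}$. $\rho_\theta^k$ is the $k$-fold composition of $\rho_\theta$, with $\rho_\theta^0$ the identity. MAH($\infty$) stands for Hilbert-valued moving average of infinite order. *)

(* Defs.v *)
From HB Require Import structures.
From mathcomp Require Export all_boot all_order all_algebra.
From mathcomp Require Export all_classical all_reals all_analysis.
From mathcomp Require Export measurable_realfun ring_quotient.

#[export] Set Implicit Arguments.
#[export] Unset Strict Implicit.
#[export] Unset Printing Implicit Defensive.

Export Order.TTheory GRing.Theory Num.Theory.
Export numFieldNormedType.Exports.

Global Open Scope classical_set_scope.
Global Open Scope ring_scope.

(* The library type [LspaceType mu _] of
   classes of p-integrable functions carries neither a vector space structure
   nor a norm, so L^2(mu) is taken here as the quotient of the library's vector
   space [LfunType mu _] of square integrable functions by the subspace of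
   functions that vanish mu-a.e., normed by the library's [Lnorm]. *)
Section L2.
Context d (T : measurableType d) (R : realType) (mu : {measure set T -> \bar R}).

Notation L2fun := (LfunType mu (@lee1n R 2)).

Definition ae_zero : {pred L2fun} :=
  mem [set f : L2fun | {ae mu, forall x, f x = 0}].

Lemma ae_zero_zmod_closed : zmod_closed ae_zero.
Proof.
split; first by rewrite inE/=; exact: aeW.
move=> f g; rewrite !inE/= => f0 g0.
apply: filterS2 f0 g0 => x fx gx.
by rewrite [LHS](_ : _ = f x - g x)// fx gx subr0.
Qed.

HB.instance Definition _ :=
  GRing.isZmodClosed.Build L2fun ae_zero ae_zero_zmod_closed.

Definition L2space := Quotient.quot ae_zero.
HB.instance Definition _ := GRing.Zmodule.on L2space.

Definition L2rep (x : L2space) : T -> R := (repr x : L2fun).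

Definition L2pi (f : L2fun) : L2space := \pi_(Quotient.quot ae_zero)%qT f.

Lemma L2pi_eq (f g : L2fun) : {ae mu, forall x, f x = g x} <-> L2pi f = L2pi g.
Proof.
rewrite /L2pi; split.
- move=> fg; apply/eqP; rewrite -Quotient.idealrBE inE/=.
  by apply: filterS fg => x fgx; rewrite [LHS](_ : _ = f x - g x)// fgx subrr.
- move=> /eqP; rewrite -Quotient.idealrBE inE/=.
  apply: filterS => x; rewrite [X in X = _ -> _](_ : _ = f x - g x)//.
  by move=> /eqP; rewrite subr_eq0 => /eqP.
Qed.

Lemma L2reprK (x : L2space) : L2pi (repr x) = x.
Proof. exact: reprK. Qed.

Lemma L2repr_pi (f : L2fun) : {ae mu, forall x, (repr (L2pi f) : L2fun) x = f x}.
Proof. by apply/L2pi_eq; rewrite L2reprK. Qed.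

Lemma L2piD (f g : L2fun) : L2pi (f + g) = L2pi f + L2pi g.
Proof. by rewrite /L2pi raddfD. Qed.

Definition L2scale (a : R) (x : L2space) : L2space := L2pi (a *: (repr x : L2fun)).

Lemma L2scale_pi a (f : L2fun) : L2scale a (L2pi f) = L2pi (a *: f).
Proof.
apply/L2pi_eq; apply: filterS (L2repr_pi f) => x fx.
by rewrite [LHS](_ : _ = a * (repr (L2pi f) : L2fun) x)// fx.
Qed.

Lemma L2scaleA a b v : L2scale a (L2scale b v) = L2scale (a * b) v.
Proof. by rewrite -(L2reprK v) !L2scale_pi scalerA. Qed.

Lemma L2scale1 : left_id 1 L2scale.
Proof. by move=> v; rewrite -(L2reprK v) L2scale_pi scale1r. Qed.

Lemma L2scaleDr : right_distributive L2scale +%R.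
Proof.
move=> a u v; rewrite -(L2reprK u) -(L2reprK v) -L2piD !L2scale_pi -L2piD.
by rewrite scalerDr.
Qed.

Lemma L2scaleDl v : {morph L2scale^~ v : a b / a + b}.
Proof. by move=> a b; rewrite -(L2reprK v) !L2scale_pi -L2piD scalerDl. Qed.

HB.instance Definition _ :=
  GRing.Zmodule_isLmodule.Build R L2space L2scaleA L2scale1 L2scaleDr L2scaleDl.

Definition L2norm (x : L2space) : R := fine ('N[mu]_2[EFin \o L2rep x])%E.

Lemma L2norm_pi (f : L2fun) : L2norm (L2pi f) = fine ('N[mu]_2[EFin \o f])%E.
Proof.
rewrite /L2norm; congr fine; rewrite unlock /Lnorm; congr (_ `^ _)%E.
have mg (g : L2fun) :
    measurable_fun setT (fun x => (`|(EFin \o g) x| `^ 2%R)%E).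
  apply: (measurableT_comp (measurable_poweR _)) => //.
  by apply: measurableT_comp => //; apply/measurable_EFinP.
apply: ae_eq_integral => //; first exact: mg.
by apply: filterS (L2repr_pi f) => x fx _; rewrite /L2rep/= fx.
Qed.

Lemma L2normD x y : L2norm (x + y) <= L2norm x + L2norm y.
Proof.
rewrite -(L2reprK x) -(L2reprK y) -L2piD !L2norm_pi.
exact: ler_LnormD.
Qed.

Lemma L2normZ a x : L2norm (a *: x) = `|a| * L2norm x.
Proof.
rewrite -(L2reprK x) [_ *: _]L2scale_pi !L2norm_pi.
have := LnormZ (repr x : L2fun) a.
by rewrite -(finite_norm_fine (repr x : L2fun)) => ->.
Qed.

Lemma L2norm_eq0 x : L2norm x = 0 -> x = 0.
Proof.
rewrite -(L2reprK x) L2norm_pi => /fine_Lnormr_eq0 x0.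
rewrite -(raddf0 \pi_(Quotient.quot ae_zero)%qT); apply/L2pi_eq.
by apply: filterS x0 => t /(_ I).
Qed.

HB.instance Definition _ :=
  Lmodule_isNormed.Build R L2space L2normD L2normZ L2norm_eq0.

(* The junk value is the class of 0 when [f] is not square integrable. *)
Definition L2class (f : T -> R) : L2space := L2pi (insubd (0 : L2fun) f).

Definition L2dot (x y : L2space) : R := \int[mu]_t (L2rep x t * L2rep y t).

End L2.

Section hilbertian_processes.
Context d (Omega : measurableType d) (R : realType) (P : probability Omega R).
Context (H : normedModType R).

Definition borel_set : set (set H) := <<s [set U : set H | open U] >>.

Definition random_element (Y : Omega -> H) : Prop :=
  forall B, borel_set B -> measurable (Y @^-1` B).

Definition strictly_stationary (Y : int -> Omega -> H) : Prop :=
  forall (k : nat) (n : 'I_k -> int) (m : int) (B : 'I_k -> set H),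
    (forall i, borel_set (B i)) ->
    P (\bigcap_i (Y (n i + m) @^-1` B i)) = P (\bigcap_i (Y (n i) @^-1` B i)).

Definition bounded_operator (rho : H -> H) : Prop :=
  linear rho /\ exists C : R, forall x, `|rho x| <= C * `|x|.

Definition autoregressive (rho : H -> H) (eps Y : int -> Omega -> H) : Prop :=
  (forall n, random_element (Y n)) /\
  forall n, {ae P, forall w, Y n w = rho (Y (n - 1) w) + eps n w}.

Definition MAH_sum (rho : H -> H) (eps : int -> Omega -> H) (n : int)
    (N : nat) (w : Omega) : H :=
  \sum_(k < N) iter k rho (eps (n - k%:Z) w).

(* Convergence of the series both almost surely in [H] and in L^2_H(P). *)
Definition MAH_representation (rho : H -> H) (eps Y : int -> Omega -> H) :=
  forall n,
    {ae P, forall w, MAH_sum rho eps n N w @[N --> \oo] --> Y n w} /\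
    (\int[P]_w (`|Y n w - MAH_sum rho eps n N w| ^+ 2)%:E)%E @[N --> \oo]
      --> 0%E.

End hilbertian_processes.

(* Mean and cross-covariance operators are compared through their values on
   the inner product, which determine them. *)
Definition weakly_stationary d (Omega : measurableType d) (R : realType)
    (P : probability Omega R) d' (T : measurableType d')
    (mu : {measure set T -> \bar R}) (Y : int -> Omega -> L2space mu) : Prop :=
  [/\ forall n, (\int[P]_w (`|Y n w| ^+ 2)%:E < +oo)%E,
      forall n m x,
        ('E_P[fun w => L2dot (Y (n + m)%R w) x] = 'E_P[fun w => L2dot (Y n w) x])%E &
      forall n n' m x y,
        covariance P (fun w => L2dot (Y (n + m) w) x)
                     (fun w => L2dot (Y (n' + m) w) y) =
        covariance P (fun w => L2dot (Y n w) x) (fun w => L2dot (Y n' w) y)].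

Section wiener.
Context d (Omega : measurableType d) (R : realType) (P : probability Omega R).

Record bilateral_wiener (W : R -> Omega -> R) : Prop := {
  wiener_measurable : forall t, measurable_fun setT (W t) ;
  wiener_0 : {ae P, forall w, W 0 w = 0} ;
  wiener_normal : forall s t, s < t -> forall B, measurable B ->
    P ((fun w => W t w - W s w) @^-1` B) = normal_prob 0 (Num.sqrt (t - s)) B ;
  wiener_independent : forall (k : nat) (t : nat -> R) (B : nat -> set R),
    {homo t : i j / (i <= j)%N >-> i <= j} -> (forall i, measurable (B i)) ->
    P (\bigcap_(i < k) ((fun w => W (t i.+1) w - W (t i) w) @^-1` B i)) =
    (\prod_(i < k) P ((fun w => (W (t i.+1) w - W (t i) w)%R) @^-1` B i))%E ;
  wiener_continuous : {ae P, forall w, continuous (fun t => W t w)} }.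

(* A triple [(c, (a, b))] stands for [c] times the indicator of ]a, b]. *)
Definition step_data := seq (R * (R * R)).

Definition step_wf (s : step_data) : bool := all (fun i => i.2.1 <= i.2.2) s.

Definition step_fun (s : step_data) (x : R) : R :=
  \sum_(i <- s) i.1 * \1_(`]i.2.1, i.2.2]) x.

Definition step_integral (W : R -> Omega -> R) (s : step_data) (w : Omega) : R :=
  \sum_(i <- s) i.1 * (W i.2.2 w - W i.2.1 w).

(* [wiener_integral W f Y]: [Y] is a version of the integral of [f] over the
   whole line with respect to [W], defined by the isometry of L^2(dx) into
   L^2(P) as a limit of integrals of step functions. *)
Definition wiener_integral (W : R -> Omega -> R) (f : R -> R)
    (Y : Omega -> R) : Prop :=
  [/\ measurable_fun setT f, measurable_fun setT Y &
    exists s : nat -> step_data,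
      [/\ forall k, step_wf (s k),
          (\int[lebesgue_measure]_x ((f x - step_fun (s k) x) ^+ 2)%:E)%E
            @[k --> \oo] --> 0%E &
          (\int[P]_w ((Y w - step_integral W (s k) w) ^+ 2)%:E)%E
            @[k --> \oo] --> 0%E]].

Definition ornstein_uhlenbeck (W : R -> Omega -> R) (theta : R)
    (xi : R -> Omega -> R) : Prop :=
  (forall t, wiener_integral W
     (fun s => expR (- theta * (t - s)) * \1_(`]-oo, t]) s) (xi t)) /\
  forall w, continuous (fun t => xi t w).

(* As for the Ornstein-Uhlenbeck process, the versions of the integrals are
   chosen so that the paths, here on [0, h], are continuous. *)
Definition ou_innovation (W : R -> Omega -> R) (theta h : R)
    (eps : int -> R -> Omega -> R) : Prop :=
  forall n,
    (forall t, 0 <= t <= h -> wiener_integral W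
       (fun s => expR (- theta * (n%:~R * h + t - s)) *
                 \1_(`[n%:~R * h, n%:~R * h + t]) s) (eps n t)) /\
    forall w, {within `[0, h], continuous (fun t => eps n t w)}.

End wiener.

Section spaceH.
Context (R : realType) (h : R).

Definition muH : {measure set (measurableTypeR R) -> \bar R} :=
  measure_add (mrestr lebesgue_measure (measurable_itv `[0, h]))
              (dirac (h : measurableTypeR R)).

(* [0, h] carries the whole mass of [muH h], hence the values outside of [0, h]
   of a function on the line are irrelevant. *)
Definition spaceH := L2space muH.
HB.instance Definition _ := NormedModule.on spaceH.

Definition in_H (f : R -> R) : Prop := f \_ `[0, h] \in Lfun muH 2%:E.

Definition toH (f : R -> R) : spaceH := L2class muH (f \_ `[0, h]).

(* [h] is an atom of [muH h], hence the value at [h] depends on the class only. *)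
Definition evalh (x : spaceH) : R := L2rep x h.

Definition rhoH (theta : R) (x : spaceH) : spaceH :=
  toH (fun t => expR (- theta * t) * evalh x).

Lemma normHE (x : spaceH) :
  ((`|x| ^+ 2)%:E = \int[lebesgue_measure]_(t in `[0%R, h]) ((L2rep x t) ^+ 2)%:E
     + ((evalh x) ^+ 2)%:E)%E.
Proof.
pose f : LfunType muH (@lee1n R 2) := repr x.
have mf : measurable_fun [set: measurableTypeR R] (fun t => (f t ^+ 2)%:E).
  by apply/measurable_EFinP; apply: measurable_funX.
have mE : measurable (`[0, h] : set (measurableTypeR R)) by exact: measurable_itv.
transitivity (\int[muH]_t (f t ^+ 2)%:E)%E.
  transitivity ('N[muH]_2[EFin \o f] `^ 2)%E.
    rewrite -finite_norm_fine poweR_EFin.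
    by rewrite -[fine _]/(`|x|) powR_mulrn.
  rewrite powR_Lnorm//; apply: eq_integral => t _ /=.
  by rewrite powR_mulrn// real_normK// num_real.
rewrite ge0_integral_measure_add//; last by move=> t _; rewrite lee_fin sqr_ge0.
congr (_ + _)%E.
- rewrite (@ge0_negligible_integral _ _ _ _ _ (~` `[0, h] : set (measurableTypeR R))) //=.
  + rewrite setTD setCK.
    by apply: eq_measure_integral => /= A mA Ah; rewrite /mrestr setIidl.
  + exact: measurableC.
  + by move=> t _; rewrite lee_fin sqr_ge0.
  + by rewrite /mrestr setICl measure0.
- by rewrite integral_dirac// diracT mul1e.
Qed.

Lemma evalh_toH (f : R -> R) :
  0 <= h -> in_H f -> evalh (toH f) = f h.
Proof.
move=> h0 fH.
have := @L2repr_pi _ _ _ muH (insubd (0 : LfunType muH (@lee1n R 2)) (f \_ `[0, h])).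
case=> A [mA muA]; rewrite -/(toH f) => sub.
have Ah : ~ A h.
  move=> Ah; have := muA.
  rewrite /muH/= /measure_add/= /msum !big_ord_recr/= big_ord0 add0e.
  rewrite diracE mem_set// => /eqP.
  by rewrite gt_eqF// (@lt_le_trans _ _ 1%E)// leeDr.
have : (repr (toH f) : LfunType muH (@lee1n R 2)) h = (f \_ `[0, h]) h.
  have := contra_not (sub h) Ah => /contrapT ->.
  by have := insubdK (0 : LfunType muH (@lee1n R 2)) fH => /= ->.
by rewrite patchE mem_set// /= in_itv/= h0 lexx.
Qed.

End spaceH.

(* Main.v *)
From HB Require Import structures.
Require Import Defs.
From mathcomp Require Import ring lra.

(* Since rho x is the multiple by x(h) of the fixed vector t |-> exp (- theta t),
   rho^(k+1) has norm of order exp (- theta h)^k and sees x through x(h) only.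
   Iterating the equation N times expresses a solution at time n as the N-th
   partial sum of the moving average plus rho^N of the solution at time n - N.
   For X the remainder is controlled by E xi_t^2, which does not depend on t, and
   vanishes in mean square and, by summability, almost surely. For two
   stationary solutions the values at h form a tight family, so that the
   difference vanishes almost surely.

   The equation for X is an identity between integrands at each fixed t, hence an
   almost sure identity of integrals by the isometry, and extends to all t by
   continuity of the paths. Stationarity of X requires no Gaussian computation:
   xi_t and xi_(t+r) are the same measurable functional of the increments of W and
   of their translates by r, which have the same law, and X_n is a measurable
   functional of the path of xi. *)

(** * Laws of processes *)

(** Uniqueness is claimed for strictly and for weakly stationary solutions alike, and a strictly
    stationary solution may have no moments at all, which rules out a mean-square argument.
    Tightness of the values at h is what the two notions share: a single law is tight, and a
    constant mean and variance bound the second moments.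

    The other obstacle is measurability in H. Since [borel_set] is generated by the open sets, a sum
    of random elements is not known here to be a random element. Measurability is therefore read on
    paths: a continuous process with measurable coordinates yields a random element through [toH],
    and a continuous functional of a random element, such as the value at h, is a real random
    variable.

    Exceptional null sets for uncountably many times are never united: laws involve finitely many
    times, and identities between paths are first obtained at countably many times. *)

Section path_space.
Context {R : realType}.

Definition cylinders (I : Type) : set (set (I -> R)) :=
  [set A | exists n (i : nat -> I) (B : nat -> set R),
     (forall j, measurable (B j)) /\
     A = [set x | forall j, (j < n)%N -> B j (x (i j))]].

Definition pathspace (I : pointedType) :=
  g_sigma_algebraType (@cylinders I).

HB.instance Definition _ (I : pointedType) := Measurable.on (pathspace I).

Lemma measurable_eval (I : pointedType) (i : I) :
  measurable_fun setT ((fun x => x i) : pathspace I -> R).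
Proof.
move=> _ B mB; rewrite setTI; apply: sub_sigma_algebra.
exists 1%N, (fun=> i), (fun=> B); split => //.
apply/seteqP; split => x /=; first by move=> ? [].
by move=> /(_ 0%N); exact.
Qed.

Lemma measurable_to_path d (T : measurableType d) (I : pointedType)
    (X : T -> pathspace I) :
  (forall i, measurable_fun setT (fun w => X w i)) -> measurable_fun setT X.
Proof.
move=> mX; apply: (@measurability _ _ T (pathspace I) setT X (@cylinders I)) => //.
move=> _ [A [n [i [B [mB ->]]]] <-]; rewrite setTI.
rewrite (_ : X @^-1` _ = \bigcap_(j < n) ((fun w => X w (i j)) @^-1` B j)).
  apply: bigcap_measurableType => j _.
  by rewrite -[X in measurable X]setTI; exact: mX.
by apply/seteqP; split => w /= H j; exact: H.
Qed.

Lemma setI_closed_cylinders (I : Type) : setI_closed (@cylinders I).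
Proof.
move=> _ _ [n [i [B [mB ->]]]] [m [k [C [mC ->]]]].
exists (n + m)%N, (fun j => if (j < n)%N then i j else k (j - n)%N),
  (fun j => if (j < n)%N then B j else C (j - n)%N); split.
  by move=> j; case: ifPn.
apply/seteqP; split => x /=.
- move=> [Hn Hm] j jnm; case: ifPn => jn; first exact: Hn.
  by apply: Hm; rewrite ltn_subLR// leqNgt.
- move=> H; split => j jn.
  + by have := H j; rewrite jn; apply; rewrite ltn_addr.
  + have := H (n + j)%N; rewrite (ltnNge (n + j) n) leq_addr/= addKn; apply.
    by rewrite ltn_add2l.
Qed.

Context d (Omega : measurableType d) (P : probability Omega R).

Definition same_law (I : pointedType) (X X' : Omega -> pathspace I) : Prop :=
  [/\ measurable_fun setT X, measurable_fun setT X' &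
   forall C, measurable C -> P (X @^-1` C) = P (X' @^-1` C)].

(** Cylinders generate the sigma-algebra and are stable under intersection, so two probabilities
    that agree on them coincide. *)
Lemma same_law_cylinders (I : pointedType) (X X' : Omega -> pathspace I) :
  measurable_fun setT X -> measurable_fun setT X' ->
  (forall n (i : nat -> I) (B : nat -> set R), (forall j, measurable (B j)) ->
    P [set w | forall j, (j < n)%N -> B j (X w (i j))] =
    P [set w | forall j, (j < n)%N -> B j (X' w (i j))]) ->
  same_law X X'.
Proof.
move=> mX mX' XX'; split=> // C mC.
suff : distribution P (mfun_Sub (mem_set mX)) C =
       distribution P (mfun_Sub (mem_set mX')) C by [].
set m1 := distribution P _; set m2 := distribution P _.
apply: (@measure_unique _ R (pathspace I) (@cylinders I) (fun=> setT) erefl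
  (@setI_closed_cylinders I) _ _ m1 m2) => //.
- move=> _; exists 1%N, (fun=> point), (fun=> setT); split => //.
  by apply/seteqP; split.
- by apply: bigcup_const; exists 0%N.
- by move=> _ [n [i [B [mB ->]]]]; exact: XX'.
- by move=> _; exact: (le_lt_trans (probability_le1 m1 measurableT) (ltry _)).
Qed.

Lemma same_law_comp (I J : pointedType) (F : pathspace I -> pathspace J)
    (X X' : Omega -> pathspace I) :
  measurable_fun setT F -> same_law X X' -> same_law (F \o X) (F \o X').
Proof.
move=> mF [mX mX' XX']; split; [exact: measurableT_comp|exact: measurableT_comp|].
move=> C mC; apply: (XX' (F @^-1` C)).
by rewrite -[X in measurable X]setTI; exact: mF.
Qed.

Lemma measure_eq_ae d' (T : measurableType d')
    (mu : {measure set T -> \bar R}) (A B : set T) :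
  measurable A -> measurable B -> {ae mu, forall w, A w <-> B w} ->
  mu A = mu B.
Proof.
move=> mA mB [N [mN N0 sN]].
rewrite -(measureU0 mA mN N0) -(measureU0 mB mN N0); congr (mu _).
by apply/seteqP; split => w [ABw|Nw]; [|by right| |by right];
  have [|nNw] := pselect (N w); try (by right); left;
  have /contrapT /= := contra_not (sN w) nNw; tauto.
Qed.

(** The null set may depend on the index: a cylinder constrains finitely many coordinates, so an
    uncountable union of null sets never arises. *)
Lemma same_law_ae (I : pointedType) (X X' Y Y' : Omega -> pathspace I) :
  measurable_fun setT Y -> measurable_fun setT Y' ->
  (forall i, {ae P, forall w, X w i = Y w i}) ->
  (forall i, {ae P, forall w, X' w i = Y' w i}) ->
  same_law X X' -> same_law Y Y'.
Proof.
move=> mY mY' XY XY' [mX mX' XX']; apply: same_law_cylinders => // n i B mB.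
pose C : set (pathspace I) := [set x | forall j, (j < n)%N -> B j (x (i j))].
have mC : measurable C by apply: sub_sigma_algebra; exists n, i, B.
have cyl (U V : Omega -> pathspace I) :
    measurable_fun setT U -> measurable_fun setT V ->
    (forall i, {ae P, forall w, U w i = V w i}) ->
    P (U @^-1` C) = P (V @^-1` C).
  move=> mU mV UV; apply: measure_eq_ae.
  - by rewrite -[X in measurable X]setTI; exact: mU.
  - by rewrite -[X in measurable X]setTI; exact: mV.
  have : {ae P, forall w, forall j, U w (i j) = V w (i j)}.
    by apply/ae_foralln => j; exact: UV.
  by apply: filterS => w E; split=> H j jn; have := H j jn; rewrite E.
by rewrite -[LHS](cyl X Y)// -[RHS](cyl X' Y')//; exact: XX'.
Qed.

Lemma same_law_ge0_integral (I : pointedType) (X X' : Omega -> pathspace I)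
    (F : pathspace I -> \bar R) :
  measurable_fun setT F -> (forall x, 0 <= F x)%E -> same_law X X' ->
  (\int[P]_w F (X w) = \int[P]_w F (X' w))%E.
Proof.
move=> mF F0 [mX mX' XX'].
rewrite -[LHS]/(\int[P]_(w in X @^-1` setT) (F \o X) w)%E.
rewrite -[RHS]/(\int[P]_(w in X' @^-1` setT) (F \o X') w)%E.
rewrite -!ge0_integral_pushforward//.
apply: eq_measure_integral => A mA _; exact: XX'.
Qed.

(** Positive and negative parts are compared separately, so that means and covariances can be
    transferred as they are defined, as extended integrals. *)
Lemma same_law_integral (I : pointedType) (X X' : Omega -> pathspace I)
    (F : pathspace I -> \bar R) :
  measurable_fun setT F -> same_law X X' ->
  (\int[P]_w F (X w) = \int[P]_w F (X' w))%E.
Proof.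
move=> mF XX'; rewrite integralE [RHS]integralE; congr (_ - _)%E.
- have := same_law_ge0_integral (measurable_funepos mF) (@funepos_ge0 _ _ F) XX'.
  by rewrite !unlock.
- have := same_law_ge0_integral (measurable_funeneg mF) (@funeneg_ge0 _ _ F) XX'.
  by rewrite !unlock.
Qed.
End path_space.

(** * The Wiener integral *)

Section affine_change_of_variables.
Context {R : realType}.
Notation mu := (@lebesgue_measure R).
Local Open Scope ereal_scope.

(** The image of Lebesgue measure under x |-> a x + b, multiplied by a, gives each interval ]c, d]
    its length, which characterises Lebesgue measure. *)
Lemma ge0_integral_affine (f : R -> \bar R) (a b : R) : (0 < a)%R ->
  measurable_fun setT f -> (forall x, 0 <= f x) ->
  \int[mu]_x f x = a%:E * \int[mu]_x f (a * x + b)%R.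
Proof.
move=> a0 mf f0.
pose phi : measurableTypeR R -> measurableTypeR R := fun x : R => (a * x + b)%R.
have mphi : measurable_fun setT phi.
  by apply: measurable_funD => //; exact: measurable_funM.
pose m := mscale (NngNum (ltW a0))
  (measure_function_pushforward__canonical__measure_function_Measure mu mphi).
have muE A : measurable A -> mu A = m A.
  apply: (@lebesgue_measure_unique R m) => _ [[c d] _ <-] /=.
  rewrite /m /mscale /= /pushforward.
  have -> : phi @^-1` `]c, d] = `](a^-1 * (c - b))%R, (a^-1 * (d - b))%R]%classic.
    apply/seteqP; split => x /=; rewrite /phi !in_itv/= => /andP[cx xd]; apply/andP; split.
    - by rewrite mulrC ltr_pdivrMr// mulrC ltrBlDr.
    - by rewrite mulrC ler_pdivlMr// mulrC lerBrDr.
    - by move: cx; rewrite mulrC ltr_pdivrMr// mulrC ltrBlDr.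
    - by move: xd; rewrite mulrC ler_pdivlMr// mulrC lerBrDr.
  rewrite !lebesgue_measure_itv/= !lte_fin.
  rewrite ltr_pM2l ?invr_gt0// ltrD2r.
  case: ifPn => [_|]; last by rewrite mule0.
  rewrite -!EFinB -EFinM -mulrBr mulrA mulfV ?gt_eqF// mul1r.
  by congr (_%:E); ring.
transitivity (\int[m]_x f x).
  by apply: eq_measure_integral => A mA _; exact: muE.
by rewrite ge0_integral_mscale// ge0_integral_pushforward.
Qed.

End affine_change_of_variables.

Section normal_moment.
Context {R : realType}.
Notation mu := (@lebesgue_measure R).
Local Open Scope ereal_scope.

(** The Radon-Nikodym derivative and [normal_pdf] have the same integral over every measurable set,
    hence agree almost everywhere. *)
Lemma ge0_integral_normal_prob (s : R) (f : R -> \bar R) :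
  measurable_fun setT f -> (forall x, 0 <= f x) ->
  \int[normal_prob 0 s]_x f x = \int[mu]_x (f x * (normal_pdf 0 s x)%:E).
Proof.
move=> mf f0; pose g := Radon_Nikodym_SigmaFinite.f (normal_prob 0 s) mu.
have dom := @normal_prob_dominates R 0 s.
have mg : measurable_fun setT g.
  exact: measurable_int (Radon_Nikodym_SigmaFinite.f_integrable dom).
rewrite -(Radon_Nikodym_SigmaFinite.change_of_variables dom f0)//.
apply: ae_eq_integral => //.
- exact: emeasurable_funM.
- by apply: emeasurable_funM => //; apply/measurable_EFinP; exact: measurable_normal_pdf.
apply: ae_eqe_mul2l; apply: integral_ae_eq => //.
- exact: Radon_Nikodym_SigmaFinite.f_integrable.
- by apply/measurable_EFinP; exact: measurable_normal_pdf.
- by move=> E _ mE; rewrite -(Radon_Nikodym_SigmaFinite.f_integral dom).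
Qed.

Definition normal_moment2 : \bar R := \int[normal_prob (0:R) 1]_x (x ^+ 2)%:E.

Lemma normal_moment2_scale (s : R) : (0 < s)%R ->
  \int[normal_prob 0 s]_x (x ^+ 2)%:E = (s ^+ 2)%:E * normal_moment2.
Proof.
move=> s0.
have msq : measurable_fun setT (fun x : R => (x ^+ 2)%:E).
  by apply/measurable_EFinP; exact: measurable_funX.
have sq0 (x : R) : 0 <= (x ^+ 2)%:E by rewrite lee_fin sqr_ge0.
have mpdf (t : R) : measurable_fun setT (fun x : R => (x ^+ 2)%:E * (normal_pdf 0 t x)%:E).
  apply: emeasurable_funM => //; apply/measurable_EFinP; exact: measurable_normal_pdf.
have pdf0 (t x : R) : 0 <= (x ^+ 2)%:E * (normal_pdf 0 t x)%:E.
  by rewrite mule_ge0// lee_fin normal_pdf_ge0.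
rewrite /normal_moment2 (ge0_integral_normal_prob s msq sq0).
rewrite (ge0_integral_normal_prob 1 msq sq0).
rewrite (ge0_integral_affine 0 s0 (mpdf s) (pdf0 s)).
have maff : measurable_fun setT (fun x : R => (s * x + 0)%R).
  by apply: measurable_funD => //; exact: measurable_funM.
rewrite -[LHS]ge0_integralZl; first last.
- by rewrite lee_fin ltW.
- by move=> x _; exact: pdf0.
- exact: (measurableT_comp (mpdf s) maff).
- exact: measurableT.
rewrite -[RHS]ge0_integralZl; first last.
- by rewrite lee_fin sqr_ge0.
- by move=> x _; exact: pdf0.
- exact: mpdf.
- exact: measurableT.
apply: eq_integral => x _.
rewrite -!EFinM !addr0 !normal_pdfE ?oner_neq0 ?gt_eqF// /normal_peak /normal_fun !subr0 expr1n.
congr (_%:E).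
rewrite (_ : (s ^+ 2 * pi *+ 2) = s ^+ 2 * (1 * pi *+ 2))%R; last by ring.
rewrite sqrtrM ?sqr_ge0// sqrtr_sqr gtr0_norm// invfM.
rewrite (_ : (- (s * x) ^+ 2 / (s ^+ 2 *+ 2)) = - x ^+ 2 / (1 *+ 2))%R; last first.
  by field; rewrite gt_eqF.
set q := (_ ^-1 * _ ^-1)%R; set e := expR _.
have -> : (q = s^-1 * (Num.sqrt (1 * pi *+ 2))^-1)%R by [].
move: ((Num.sqrt _)^-1)%R e => {}q e; by field; rewrite gt_eqF.
Qed.

Lemma normal_moment2_fin : normal_moment2 \is a fin_num.
Proof.
have sq0 (x : R) : 0 <= (x ^+ 2)%:E by rewrite lee_fin sqr_ge0.
have msq : measurable_fun setT (fun x : R => (x ^+ 2)%:E).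
  by apply/measurable_EFinP; exact: measurable_funX.
rewrite ge0_fin_numE; last by apply: integral_ge0.
rewrite /normal_moment2 ge0_integral_normal_prob//.
(* y^2 exp (- y^2 / 2) <= 4 exp (- y^2 / 4), a multiple of the density of
   variance 2 *)
pose s : R := Num.sqrt 2.
have s0 : (s != 0)%R by rewrite gt_eqF// sqrtr_gt0.
pose c := (4 * normal_peak (1:R) / normal_peak s)%R.
apply: (@le_lt_trans _ _ (\int[mu]_x (c%:E * (normal_pdf 0 s x)%:E))).
  apply: ge0_le_integral => //.
  - by move=> x _; rewrite mule_ge0// lee_fin normal_pdf_ge0.
  - by apply: emeasurable_funM => //; apply/measurable_EFinP; exact: measurable_normal_pdf.
  - by apply: emeasurable_funM => //; apply/measurable_EFinP; exact: measurable_normal_pdf.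
  move=> x _; rewrite -!EFinM lee_fin !normal_pdfE ?oner_neq0//.
  rewrite /c; have p0 := normal_peak_gt0 (oner_neq0 R); have q0 := normal_peak_gt0 s0.
  set p := normal_peak 1 in p0 *; set q := normal_peak s in q0 *.
  rewrite mulrCA (_ : 4 * p / q * _ = p * (4 * normal_fun 0 s x))%R; last first.
    by field; rewrite gt_eqF.
  rewrite ler_pM2l// /normal_fun !subr0 expr1n sqr_sqrtr//.
  rewrite (_ : - x ^+ 2 / (1 *+ 2) = - x ^+ 2 / (2 *+ 2) - x ^+ 2 / 4)%R; last by field.
  rewrite expRD mulrCA mulrC ler_pM2r ?expR_gt0//.
  rewrite expRN ler_pdivrMr ?expR_gt0//.
  have := expR_ge1Dx (x ^+ 2 / 4)%R; lra.
rewrite integralZl//; last exact: integrable_normal_pdf.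
by rewrite integral_normal_pdf mule1 ltry.
Qed.

End normal_moment.

(** * The isometry between step functions and their integrals *)

Section interval_overlap.
Context {R : realType}.

Lemma indic_itvM (a b c e : R) :
  (fun x : R => \1_(`]a, b]) x * \1_(`]c, e]) x : R) =
  \1_(`]Num.max a c, Num.min b e]).
Proof.
apply/funext => x; rewrite -[LHS]/((\1_(`]a, b]) \* \1_(`]c, e])) x) -indicI.
congr (\1_ _ x); apply/seteqP; split => y /=; rewrite !in_itv/= gt_max le_min.
  by move=> [/andP[-> ->] /andP[-> ->]].
by move=> /andP[/andP[-> ->] /andP[-> ->]].
Qed.

(** The overlap is expressed by distances between end points in order to match, term by term, the
    polarization of a product of two increments. *)
Lemma overlap_length (a b c e : R) : a <= b -> c <= e ->
  (if Num.max a c < Num.min b e then Num.min b e - Num.max a c else 0) =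
  2^-1 * (`|b - c| + `|a - e| - `|b - e| - `|a - c|).
Proof.
move=> ab ce.
have N (x y : R) : `|x - y| = if x <= y then y - x else x - y.
  case: leP => xy; first by rewrite ler0_norm ?opprB// subr_le0.
  by rewrite gtr0_norm// subr_gt0.
rewrite !N /Num.max /Num.min {N}.
case: (ltgtP b c) => h1; case: (ltgtP a e) => h2; try (exfalso; lra);
case: (ltgtP a c) => h3; try (exfalso; lra);
case: (ltgtP b e) => h4; try (exfalso; lra);
match goal with |- context [if ?x < ?y then _ else _] => case: (ltP x y) => h5 end;
lra.
Qed.

Lemma Rintegral_indic_itvM (a b c e : R) : a <= b -> c <= e ->
  \int[@lebesgue_measure R]_x (\1_(`]a, b]) x * \1_(`]c, e]) x) =
  2^-1 * (`|b - c| + `|a - e| - `|b - e| - `|a - c|).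
Proof.
move=> ab ce; rewrite indic_itvM -overlap_length//.
rewrite /Rintegral integral_indic//= setIT lebesgue_measure_itv/= lte_fin.
by case: ifP.
Qed.

End interval_overlap.

Section wiener_moments.
Context d (Omega : measurableType d) (R : realType) (P : probability Omega R).
Context (W : R -> Omega -> R) (BW : bilateral_wiener P W).
Notation mu := (@lebesgue_measure R).

Let mW := wiener_measurable BW.

(* Its value 1 plays no role: the isometry is used up to this factor only. *)
Definition wvar : R := fine (@normal_moment2 R).

Lemma wvar_ge0 : 0 <= wvar.
Proof. by apply: fine_ge0; apply: integral_ge0 => x _; rewrite lee_fin sqr_ge0. Qed.

Lemma wiener_increment_moment2 s t :
  (\int[P]_w ((W t w - W s w) ^+ 2)%:E = (wvar * `|t - s|)%:E)%E.
Proof.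
wlog st : s t / s <= t.
  move=> H; have [/H//|/ltW /H E] := leP s t; rewrite distrC -E.
  apply: eq_integral => w _; congr (_ %:E); ring.
(* [wiener_normal] covers s < t only; the null increment is treated apart. *)
have [->|ne] := eqVneq s t.
  rewrite subrr normr0 mulr0 (eq_integral (cst 0%E)) ?integral0// => w _.
  by rewrite subrr expr0n.
have {ne}st' : s < t by rewrite lt_neqAle ne.
have mD : measurable_fun setT ((fun w => W t w - W s w) : Omega -> measurableTypeR R).
  exact: measurable_funB.
have msq : measurable_fun setT (fun x : R => (x ^+ 2)%:E).
  by apply/measurable_EFinP; exact: measurable_funX.
rewrite ger0_norm ?subr_ge0// mulrC EFinM fineK ?normal_moment2_fin//.
have <- : Num.sqrt (t - s) ^+ 2 = t - s by rewrite sqr_sqrtr// subr_ge0.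
rewrite -normal_moment2_scale ?sqrtr_gt0 ?subr_gt0//.
pose D : {mfun Omega >-> measurableTypeR R} :=
  @mfun_Sub _ _ Omega (measurableTypeR R) _ (mem_set mD).
transitivity (\int[distribution P D]_x (x ^+ 2)%:E)%E.
  rewrite (ge0_integral_pushforward (phi := D))//.
  by move=> x _; rewrite lee_fin sqr_ge0.
apply: (@eq_measure_integral _ (measurableTypeR R) R setT
  (normal_prob 0 (Num.sqrt (t - s))) (distribution P D)) => A mA _.
exact: (wiener_normal BW).
Qed.

(* [matched X f] is the relation between products of step integrals and products
   of step functions that bilinearity propagates to the isometry. *)
Definition matched (X : Omega -> R) (f : R -> R) : Prop :=
  [/\ P.-integrable setT (EFin \o X), mu.-integrable setT (EFin \o f) &
      \int[P]_w X w = wvar * \int[mu]_x f x].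

Lemma matchedD X Y f g : matched X f -> matched Y g ->
  matched (fun w => X w + Y w) (fun x => f x + g x).
Proof.
move=> [iX jf Xf] [iY jg Yg]; split.
- exact: (integrableD _ iX iY).
- exact: (integrableD _ jf jg).
- by rewrite !RintegralD// Xf Yg mulrDr.
Qed.

Lemma matchedZ c X f : matched X f ->
  matched (fun w => c * X w) (fun x => c * f x).
Proof.
move=> [iX jf Xf]; split.
- exact: (integrableZl _ c iX).
- exact: (integrableZl _ c jf).
- by rewrite !RintegralZl// Xf mulrCA.
Qed.

Lemma matched0 : matched (fun=> 0) (fun=> 0).
Proof.
split; [exact: integrable0|exact: integrable0|].
by rewrite !Rintegral_cst// !mul0r mulr0.
Qed.

Lemma matched_sum (I : Type) (s : seq I) X f : (forall i, matched (X i) (f i)) ->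
  matched (fun w => \sum_(i <- s) X i w) (fun x => \sum_(i <- s) f i x).
Proof.
move=> H; elim: s => [|i s IH].
  under eq_fun do rewrite big_nil; under [X in matched _ X]eq_fun do rewrite big_nil.
  exact: matched0.
under eq_fun do rewrite big_cons; under [X in matched _ X]eq_fun do rewrite big_cons.
exact: matchedD.
Qed.

Lemma integrable_increment_sqr s t :
  P.-integrable setT (EFin \o (fun w => (W t w - W s w) ^+ 2)).
Proof.
apply/integrableP; split.
  by apply/measurable_EFinP; apply: measurable_funX; exact: measurable_funB.
under eq_integral => w _ do rewrite /= ger0_norm ?sqr_ge0//.
by rewrite wiener_increment_moment2 ltry.
Qed.

Lemma Rintegral_increment_sqr s t :
  \int[P]_w (W t w - W s w) ^+ 2 = wvar * `|t - s|.
Proof. by rewrite /Rintegral wiener_increment_moment2. Qed.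

Lemma matched_increments (a b c e : R) : a <= b -> c <= e ->
  matched (fun w => (W b w - W a w) * (W e w - W c w))
          (fun x => \1_(`]a, b]) x * \1_(`]c, e]) x).
Proof.
move=> ab ce.
(* By polarization, only the moments E (W t - W s)^2 are needed. *)
have polar w : (W b w - W a w) * (W e w - W c w) =
    2^-1 * ((W b w - W c w) ^+ 2 + (W a w - W e w) ^+ 2 +
     (- 1 * (W b w - W e w) ^+ 2 + - 1 * (W a w - W c w) ^+ 2)) by field.
have I (k : R) s t :
    P.-integrable setT (EFin \o (fun w => k * (W t w - W s w) ^+ 2)).
  exact: (integrableZl _ k (integrable_increment_sqr s t)).
have J1 := integrableD measurableT (integrable_increment_sqr c b)
  (integrable_increment_sqr e a).
have J2 := integrableD measurableT (I (-1) e b) (I (-1) c a).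
have J := integrableD measurableT J1 J2.
split.
- rewrite (_ : (fun w => _) = (fun w =>
    2^-1 * ((W b w - W c w) ^+ 2 + (W a w - W e w) ^+ 2 +
     (- 1 * (W b w - W e w) ^+ 2 + - 1 * (W a w - W c w) ^+ 2)))); last exact/funext.
  exact: (integrableZl _ 2^-1 J).
- by rewrite indic_itvM; exact: integrable_indic_itv.
- rewrite Rintegral_indic_itvM//.
  under eq_Rintegral do rewrite polar.
  rewrite (RintegralZl _ measurableT J) (RintegralD measurableT J1 J2).
  rewrite (RintegralD measurableT (integrable_increment_sqr c b) (integrable_increment_sqr e a)).
  rewrite (RintegralD measurableT (I (-1) e b) (I (-1) c a)).
  rewrite !(RintegralZl _ measurableT (integrable_increment_sqr _ _)).
  rewrite !Rintegral_increment_sqr; ring.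
Qed.

(** The intervals of [s] may overlap, so both squares are expanded into double sums, whose terms
    correspond by [matched_increments]. *)
Lemma step_integral_isometry (s : step_data R) : step_wf s ->
  (\int[P]_w ((step_integral W s w) ^+ 2)%:E =
   wvar%:E * \int[mu]_x ((step_fun s x) ^+ 2)%:E)%E.
Proof.
move=> wf.
(* [matched_sum] asks for a relation at every index, not only at those in the list; each interval is
   therefore bundled with the order of its end points. *)
pose T := {i : R * (R * R) | i.2.1 <= i.2.2}.
have [s' ->] : exists s' : seq T, s = map sval s'.
  elim: s wf => [|i s IH]; first by exists [::].
  move=> /= /andP[iwf /IH[s' ->]]; exists (exist _ i iwf :: s') => //.
pose X w := \sum_(i <- s') \sum_(j <- s')
  ((sval i).1 * (sval j).1) * ((W (sval i).2.2 w - W (sval i).2.1 w) *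
     (W (sval j).2.2 w - W (sval j).2.1 w)).
pose f x : R := \sum_(i <- s') \sum_(j <- s')
  ((sval i).1 * (sval j).1) * (\1_(`](sval i).2.1, (sval i).2.2]) x *
     \1_(`](sval j).2.1, (sval j).2.2]) x).
have [iX jf Xf] : matched X f.
  apply: matched_sum => i; apply: matched_sum => j; apply: matchedZ.
  by apply: matched_increments; [exact: (svalP i)|exact: (svalP j)].
have XE w : step_integral W (map sval s') w ^+ 2 = X w.
  rewrite /step_integral big_map expr2 mulr_suml; apply: eq_bigr => i _.
  rewrite mulr_sumr; apply: eq_bigr => j _; ring.
have fE x : step_fun (map sval s') x ^+ 2 = f x.
  rewrite /step_fun big_map expr2 mulr_suml; apply: eq_bigr => i _.
  rewrite mulr_sumr; apply: eq_bigr => j _; ring.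
under eq_integral do rewrite XE; under [in RHS]eq_integral do rewrite fE.
move: Xf; rewrite /Rintegral => Xf.
rewrite -(fineK (integrable_fin_num measurableT iX)).
rewrite -(fineK (integrable_fin_num measurableT jf)) -EFinM.
by congr EFin.
Qed.

End wiener_moments.

(** * Translation invariance of the law of the increments *)

Section wiener_law.
Context d (Omega : measurableType d) (R : realType) (P : probability Omega R).
Context (W : R -> Omega -> R) (BW : bilateral_wiener P W).

Let mW := wiener_measurable BW.

Lemma measurable_increment s t : measurable_fun setT (fun w => W t w - W s w).
Proof. exact: measurable_funB. Qed.

Lemma increment_law_shift (s t r r' : R) B : s <= t -> measurable B ->
  P ((fun w => W (t + r) w - W (s + r) w) @^-1` B) =
  P ((fun w => W (t + r') w - W (s + r') w) @^-1` B).
Proof.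
rewrite le_eqVlt => /predU1P[->|st] mB.
  by congr (P _); apply/seteqP; split => w /=; rewrite !subrr.
have st' u : s + u < t + u by rewrite ltrD2r.
have Er := wiener_normal BW (st' r) mB; have Er' := wiener_normal BW (st' r') mB.
have e : t + r - (s + r) = t + r' - (s + r') by ring.
exact: (etrans Er (etrans
  (f_equal (fun u => normal_prob 0 (Num.sqrt u) B) e) (esym Er'))).
Qed.

Definition grid_increments (t : nat -> R) (r : R) (w : Omega) : @pathspace R nat :=
  fun k => W (t k.+1 + r) w - W (t k + r) w.

Lemma measurable_grid_increments t r : measurable_fun setT (grid_increments t r).
Proof. by apply: measurable_to_path => k; exact: measurable_increment. Qed.

Lemma same_law_grid_increments (t : nat -> R) (r r' : R) :
  {homo t : i j / (i <= j)%N >-> i <= j} ->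
  same_law P (grid_increments t r) (grid_increments t r').
Proof.
move=> tmono.
apply: same_law_cylinders; [exact: measurable_grid_increments..|].
move=> n i B mB.
pose N := (\max_(j < n) i j).+1.
(* Several constraints of the cylinder may bear on the same increment; they are merged into one
   event per increment before independence applies. *)
pose C k := \bigcap_(j in [set j | (j < n)%N /\ i j = k]) B j.
have mC k : measurable (C k) by apply: bigcap_measurableType.
have E s : P [set w | forall j, (j < n)%N -> B j (grid_increments t s w (i j))] =
    (\prod_(k < N) P ((fun w => (W (t k.+1 + s) w - W (t k + s) w)%R) @^-1` C k))%E.
  have mono : {homo (fun k => t k + s) : i j / (i <= j)%N >-> i <= j}.
    by move=> j k jk; rewrite lerD2r; exact: tmono.
  have <- := @wiener_independent _ _ _ _ _ BW N (fun k => t k + s) C mono mC.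
  congr (P _); apply/seteqP; split => w /= H.
    by move=> k _ j [jn <-]; exact: H.
  move=> j jn; apply: (H (i j)) => //=.
  by rewrite /N ltnS; exact: (leq_bigmax (Ordinal jn)).
rewrite !E; apply: eq_bigr => k _; apply: increment_law_shift => //.
exact: tmono.
Qed.

Definition increments (r : R) (w : Omega) : @pathspace R (R * R)%type :=
  fun p => W (p.2 + r) w - W (p.1 + r) w.

Lemma measurable_increments r : measurable_fun setT (increments r).
Proof. by apply: measurable_to_path => k; exact: measurable_increment. Qed.

(* The increments over finitely many intervals are sums of increments along the
   sorted list of all the end points. *)
Lemma same_law_increments (r r' : R) :
  same_law P (increments r) (increments r').
Proof.
apply: same_law_cylinders; [exact: measurable_increments..|].
move=> n i B mB.
pose pts := sort <=%R (flatten [seq [:: (i j).1; (i j).2] | j <- iota 0 n]).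
(* The default value prolongs the list by its last point, so that [t] is nondecreasing on all of
   nat. *)
pose t k := nth (last 0 pts) pts k.
have tmono : {homo t : j k / (j <= k)%N >-> j <= k}.
  move=> j k jk; rewrite /t.
  have [kp|pk] := ltnP k (size pts).
    apply: (@sorted_leq_nth _ <=%R) => //; first exact: le_trans.
    - exact: sort_le_sorted.
    - by rewrite inE; exact: leq_ltn_trans kp.
  rewrite (nth_default _ pk); have [jp|pj] := ltnP j (size pts); last first.
    by rewrite nth_default.
  rewrite (set_nth_default 0 _ jp) -nth_last.
  have p0 : (0 < size pts)%N by exact: leq_ltn_trans jp.
  apply: (@sorted_leq_nth _ <=%R) => //; first exact: le_trans.
  - exact: sort_le_sorted.
  - by rewrite inE prednK.
  - by rewrite -ltnS prednK.
have tP x : x \in pts -> t (index x pts) = x by move=> xp; rewrite /t nth_index.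
have ptsP j : (j < n)%N -> (i j).1 \in pts /\ (i j).2 \in pts.
  move=> jn; rewrite !mem_sort; split; apply/flattenP;
  by exists [:: (i j).1; (i j).2]; rewrite ?inE ?eqxx ?orbT//; apply/mapP;
     exists j => //; rewrite mem_iota.
(* A difference of two telescoping sums from the first point gives the increment whatever the order
   of the two end points. *)
pose F (x : @pathspace R nat) : @pathspace R nat := fun j =>
  \sum_(0 <= k < index (i j).2 pts) x k - \sum_(0 <= k < index (i j).1 pts) x k.
have mF : measurable_fun setT F.
  apply: measurable_to_path => j; apply: measurable_funB;
  by apply: measurable_sum => k; exact: measurable_eval.
have FE s w j : (j < n)%N -> F (grid_increments t s w) j = increments s w (i j).
  move=> /ptsP[p1 p2]; rewrite /F /grid_increments.
  rewrite !(telescope_sumr (fun k => W (t k + s) w))// !tP//.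
  rewrite /increments; ring.
have [_ _ /(_ [set x | forall j, (j < n)%N -> B j (x j)])] :=
  same_law_comp mF (same_law_grid_increments r r' tmono).
have E s : (F \o grid_increments t s) @^-1` [set x | forall j, (j < n)%N -> B j (x j)] =
    [set w | forall j, (j < n)%N -> B j (increments s w (i j))].
  by apply/seteqP; split => w /= H j jn; have := H j jn; rewrite FE.
rewrite !E; apply; apply: sub_sigma_algebra.
by exists n, id, B.
Qed.

End wiener_law.

(** * Mean-square estimates and almost sure convergence *)

Section mean_square.
Context d (T : measurableType d) (R : realType) (mu : {measure set T -> \bar R}).
Implicit Types f g : T -> R.

Lemma squeeze_cvge0 (a b c : nat -> \bar R) (C : R) :
  (forall k, 0 <= a k)%E -> (forall k, a k <= C%:E * b k + C%:E * c k)%E ->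
  b k @[k --> \oo] --> 0%E -> c k @[k --> \oo] --> 0%E ->
  a k @[k --> \oo] --> 0%E.
Proof.
move=> a0 abc b0 c0.
apply: (@squeeze_cvge _ _ _ _ (fun=> 0%E) _ (fun k => C%:E * b k + C%:E * c k)%E).
- by apply: nearW => k; rewrite a0 abc.
- exact: cvg_cst.
have -> : (0 = C%:E * 0 + C%:E * 0 :> \bar R)%E by rewrite !mule0 adde0.
by apply: cvgeD; [rewrite !mule0|exact: cvgeZl|exact: cvgeZl].
Qed.

Lemma cvge0_near_lt (u : nat -> \bar R) (e : R) : 0 < e -> u k @[k --> \oo] --> 0%E ->
  \forall k \near \oo, (u k < e%:E)%E.
Proof. by move=> e0 u0; exact: (u0 _ (nbhs_open_ereal_lt (f := fun=> e) e0)). Qed.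

Lemma measurable_sqr f : measurable_fun setT f ->
  measurable_fun setT (fun x => (f x ^+ 2)%:E).
Proof. by move=> mf; apply/measurable_EFinP; exact: measurable_funX. Qed.

Lemma ge0_sqint f : (0 <= \int[mu]_x (f x ^+ 2)%:E)%E.
Proof. by apply: integral_ge0 => x _; rewrite lee_fin sqr_ge0. Qed.

Lemma sqintZ c f : measurable_fun setT f ->
  (\int[mu]_x ((c * f x) ^+ 2)%:E = (c ^+ 2)%:E * \int[mu]_x (f x ^+ 2)%:E)%E.
Proof.
move=> mf; rewrite -ge0_integralZl ?lee_fin ?sqr_ge0//.
- by apply: eq_integral => x _; rewrite exprMn.
- exact: measurable_sqr.
- by move=> x _; rewrite lee_fin sqr_ge0.
Qed.

(** From (f + g)^2 <= 2 f^2 + 2 g^2: a replacement for the triangle inequality that stays with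
    squared norms in the extended reals. *)
Lemma sqintD_le f g : measurable_fun setT f -> measurable_fun setT g ->
  (\int[mu]_x ((f x + g x) ^+ 2)%:E <=
   2%:E * \int[mu]_x (f x ^+ 2)%:E + 2%:E * \int[mu]_x (g x ^+ 2)%:E)%E.
Proof.
move=> mf mg.
have sq0 (u : T -> R) : forall x, [set: T] x -> (0 <= (u x ^+ 2)%:E)%E.
  by move=> x _; rewrite lee_fin sqr_ge0.
have msq (u : T -> R) : measurable_fun setT u ->
    measurable_fun setT (fun x => 2%:E * (u x ^+ 2)%:E)%E.
  by move=> mu'; apply: emeasurable_funM => //; exact: measurable_sqr.
rewrite -!ge0_integralZl ?lee_fin//; try exact: measurable_sqr; try exact: sq0.
rewrite -ge0_integralD//; [|by move=> x _; rewrite mule_ge0 ?lee_fin ?sqr_ge0|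
  exact: msq|by move=> x _; rewrite mule_ge0 ?lee_fin ?sqr_ge0|exact: msq].
apply: ge0_le_integral => //.
- exact: (sq0 (fun x => f x + g x)).
- by apply: measurable_sqr; exact: measurable_funD.
- by apply: emeasurable_funD; exact: msq.
- move=> x _; rewrite -!EFinM -EFinD lee_fin.
  have := sqr_ge0 (f x - g x); rewrite !expr2; lra.
Qed.

Lemma sqintC f g :
  (\int[mu]_x ((f x - g x) ^+ 2)%:E = \int[mu]_x ((g x - f x) ^+ 2)%:E)%E.
Proof. by apply: eq_integral => x _; rewrite -sqrrN opprB. Qed.

Lemma sqint_triangle f g (h : T -> R) :
  measurable_fun setT f -> measurable_fun setT g -> measurable_fun setT h ->
  (\int[mu]_x ((f x - h x) ^+ 2)%:E <=
   2%:E * \int[mu]_x ((f x - g x) ^+ 2)%:E +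
   2%:E * \int[mu]_x ((g x - h x) ^+ 2)%:E)%E.
Proof.
move=> mf mg mh.
apply: le_trans (sqintD_le (measurable_funB mf mg) (measurable_funB mg mh)).
by rewrite le_eqVlt; apply/orP; left; apply/eqP; apply: eq_integral => x _;
  rewrite addrA subrK.
Qed.

Lemma sqint_eq0 f : measurable_fun setT f ->
  (\int[mu]_x (f x ^+ 2)%:E = 0)%E -> {ae mu, forall x, f x = 0}.
Proof.
move=> mf f0.
have /ae_eq_integral_abs : (\int[mu]_x `|(f x ^+ 2)%:E| = 0)%E.
  by rewrite -[RHS]f0; apply: eq_integral => x _; rewrite gee0_abs// lee_fin sqr_ge0.
move=> /(_ measurableT (measurable_sqr mf)); apply: filterS => x /(_ I) [] /eqP.
by rewrite sqrf_eq0 => /eqP.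
Qed.

(** The sum of the squares has a finite integral, hence is finite almost everywhere, and the terms
    of a convergent series tend to 0. *)
Lemma ae_cvg_summable (U : nat -> T -> R) :
  (forall k, measurable_fun setT (U k)) ->
  (\sum_(0 <= k <oo) \int[mu]_x (U k x ^+ 2)%:E < +oo)%E ->
  {ae mu, forall x, U k x @[k --> \oo] --> 0}.
Proof.
move=> mU sumU.
have mU2 k := measurable_sqr (mU k).
have U0 k x : [set: T] x -> (0 <= (U k x ^+ 2)%:E)%E.
  by rewrite lee_fin sqr_ge0.
have := sumU; rewrite -integral_nneseries// => intU.
have : mu.-integrable setT (fun x => \sum_(0 <= k <oo) (U k x ^+ 2)%:E)%E.
  apply/integrableP; split.
    by apply: ge0_emeasurable_sum => // k x _ _; rewrite lee_fin sqr_ge0.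
  under eq_integral => x _.
    rewrite gee0_abs; last by apply: nneseries_ge0 => k _ _; rewrite lee_fin sqr_ge0.
    over.
  exact: intU.
move=> /(integrable_ae measurableT); apply: filterS => x /(_ I) fin.
have /cvg_series_cvg_0 : cvgn (series (fun k => U k x ^+ 2)).
  apply: nnseries_is_cvg => [k|]; first exact: sqr_ge0.
  by move: fin; rewrite fin_numElt => /andP[].
move=> /cvgrPdist_lt H; apply/cvgrPdist_lt => e e0.
have e20 : 0 < e ^+ 2 by rewrite exprn_gt0.
have := H _ e20; apply: filterS => k; rewrite !sub0r !normrN normrX.
by rewrite ltr_pXn2r// ?nnegrE// ltW.
Qed.

Lemma nneseries_geometric_lty (u : nat -> \bar R) (C r : R) :
  0 <= C -> 0 < r < 1 ->
  (forall k, 0 <= u k)%E -> (forall k, u k <= (C * r ^+ k)%:E)%E ->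
  (\sum_(0 <= k <oo) u k < +oo)%E.
Proof.
move=> C0 /andP[r0 r1] u0 uC.
apply: (@le_lt_trans _ _ (C * (1 - r)^-1)%:E); last by rewrite ltry.
apply: lime_le; first by apply: is_cvg_nneseries => k _ _; exact: u0.
apply: nearW => n; apply: (@le_trans _ _ (series (geometric C r) n)%:E).
  rewrite /series/= -sumEFin; apply: lee_sum => k _; exact: uC.
by rewrite lee_fin; apply: geometric_le_lim => //; rewrite gtr0_norm.
Qed.

Lemma ae_cvg_geometric f (u : nat -> T -> R) (C r : R) :
  0 <= C -> 0 < r < 1 ->
  measurable_fun setT f -> (forall k, measurable_fun setT (u k)) ->
  (forall k, \int[mu]_x ((f x - u k x) ^+ 2)%:E <= (C * r ^+ k)%:E)%E ->
  {ae mu, forall x, u k x @[k --> \oo] --> f x}.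
Proof.
move=> C0 r01 mf mu' fu.
have : {ae mu, forall x, f x - u k x @[k --> \oo] --> 0}.
  apply: ae_cvg_summable => [k|]; first exact: measurable_funB.
  by apply: (nneseries_geometric_lty C0 r01) => // k; exact: ge0_sqint.
apply: filterS => x H; rewrite -[X in _ --> X]subr0.
rewrite (_ : (fun k => _) = fun k => f x - (f x - u k x)).
  by apply: cvgB H; exact: cvg_cst.
by apply/funext => k; rewrite opprB addrC subrK.
Qed.

End mean_square.

Section steps.
Context {R : realType}.
Implicit Type s : step_data R.

Definition step_scale (c : R) s : step_data R := [seq (c * i.1, i.2) | i <- s].
Definition step_shift (r : R) s : step_data R :=
  [seq (i.1, (i.2.1 + r, i.2.2 + r)) | i <- s].

Lemma step_wf_scale c s : step_wf (step_scale c s) = step_wf s.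
Proof. by rewrite /step_wf all_map. Qed.

Lemma step_wf_shift r s : step_wf (step_shift r s) = step_wf s.
Proof. by rewrite /step_wf all_map; apply: eq_all => i /=; rewrite lerD2r. Qed.

Lemma step_wf_cat s s' : step_wf (s ++ s') = step_wf s && step_wf s'.
Proof. exact: all_cat. Qed.

Lemma step_fun_scale c s x : step_fun (step_scale c s) x = c * step_fun s x.
Proof.
by rewrite /step_fun big_map mulr_sumr; apply: eq_bigr => i _; rewrite mulrA.
Qed.

Lemma step_fun_cat s s' x : step_fun (s ++ s') x = step_fun s x + step_fun s' x.
Proof. exact: big_cat. Qed.

Lemma step_fun_shift r s x : step_fun (step_shift r s) x = step_fun s (x - r).
Proof.
rewrite /step_fun big_map; apply: eq_bigr => i _ /=; congr (_ * _).
rewrite !indicE; congr ((_ : bool)%:R); apply/idP/idP; rewrite !inE/= !in_itv/=;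
by rewrite ltrBrDr lerBlDr.
Qed.

Lemma measurable_step_fun s : measurable_fun setT (step_fun s).
Proof.
by apply: measurable_sum => i; apply: measurable_funM => //; exact: measurable_indic.
Qed.

Context d (Omega : measurableType d) (W : R -> Omega -> R).

Lemma step_integral_scale c s w :
  step_integral W (step_scale c s) w = c * step_integral W s w.
Proof.
by rewrite /step_integral big_map mulr_sumr; apply: eq_bigr => i _; rewrite mulrA.
Qed.

Lemma step_integral_cat s s' w :
  step_integral W (s ++ s') w = step_integral W s w + step_integral W s' w.
Proof. exact: big_cat. Qed.

Lemma measurable_step_integral s : (forall t, measurable_fun setT (W t)) ->
  measurable_fun setT (step_integral W s).
Proof.
move=> mW; apply: measurable_sum => i; apply: measurable_funM => //.
exact: measurable_funB.
Qed.

End steps.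

(** * Wiener integrals as mean-square limits *)

Section wiener_integrals.
Context d (Omega : measurableType d) (R : realType) (P : probability Omega R).
Context (W : R -> Omega -> R) (BW : bilateral_wiener P W).
Notation mu := (@lebesgue_measure R).

Let mW := wiener_measurable BW.
Let mI s := measurable_step_integral s mW.

Lemma step_integral_dist (s s' : step_data R) : step_wf s -> step_wf s' ->
  (\int[P]_w ((step_integral W s w - step_integral W s' w) ^+ 2)%:E =
   (wvar R)%:E * \int[mu]_x ((step_fun s x - step_fun s' x) ^+ 2)%:E)%E.
Proof.
move=> ws ws'.
have := step_integral_isometry BW (s := s ++ step_scale (-1) s').
rewrite step_wf_cat step_wf_scale ws ws' => /(_ isT) E.
rewrite (eq_integral (fun w => (step_integral W (s ++ step_scale (-1) s') w ^+ 2)%:E)).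
  rewrite E; congr (_ * _)%E; apply: eq_integral => x _.
  by rewrite step_fun_cat step_fun_scale mulN1r.
by move=> w _; rewrite step_integral_cat step_integral_scale mulN1r.
Qed.

(** The definition provides some approximating sequence; this passes to any other one, since the
    isometry turns the distance of two step functions into that of their integrals. *)
Lemma wiener_integral_cvg (f : R -> R) (Y : Omega -> R) (s : nat -> step_data R) :
  wiener_integral P W f Y -> (forall k, step_wf (s k)) ->
  (\int[mu]_x ((f x - step_fun (s k) x) ^+ 2)%:E)%E @[k --> \oo] --> 0%E ->
  (\int[P]_w ((Y w - step_integral W (s k) w) ^+ 2)%:E)%E @[k --> \oo] --> 0%E.
Proof.
move=> [mf mY [t [wt tf tY]]] ws sf.
have tsI : (\int[P]_w ((step_integral W (t k) w - step_integral W (s k) w) ^+ 2)%:E)%E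
    @[k --> \oo] --> 0%E.
  apply: (squeeze_cvge0 (C := wvar R * 2) _ _ tf sf) => k; first exact: ge0_sqint.
  rewrite step_integral_dist// EFinM -!muleA -ge0_muleDr ?mule_ge0 ?lee_fin ?ge0_sqint//.
  apply: lee_pmul => //; rewrite ?lee_fin ?wvar_ge0 ?ge0_sqint//.
  rewrite (sqintC mu f); apply: sqint_triangle => //; exact: measurable_step_fun.
apply: (squeeze_cvge0 (C := 2) _ _ tY tsI) => k; first exact: ge0_sqint.
exact: sqint_triangle.
Qed.

(** Step functions approximating f also approximate g, so Y and Z are mean-square limits of the same
    step integrals. *)
Lemma wiener_integral_unique (f g : R -> R) (Y Z : Omega -> R) :
  wiener_integral P W f Y -> wiener_integral P W g Z ->
  {ae mu, forall x, f x = g x} -> {ae P, forall w, Y w = Z w}.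
Proof.
move=> fY gZ fg; have [mf mY [s [ws sf sY]]] := fY; have [mg mZ _] := gZ.
have sZ : (\int[P]_w ((Z w - step_integral W (s k) w) ^+ 2)%:E)%E @[k --> \oo] --> 0%E.
  apply: (wiener_integral_cvg gZ ws).
  rewrite (_ : (fun k => _) = fun k =>
    (\int[mu]_x ((f x - step_fun (s k) x) ^+ 2)%:E)%E)//.
  apply/funext => k; apply: ae_eq_integral => //.
  - by apply: measurable_sqr; apply: measurable_funB => //; exact: measurable_step_fun.
  - by apply: measurable_sqr; apply: measurable_funB => //; exact: measurable_step_fun.
  - move: fg => [N [mN N0 sN]]; exists N; split=> // x /= xN; apply: sN => /= E.
    by apply: xN => _; rewrite E.
have YZ0 : (\int[P]_w ((Y w - Z w) ^+ 2)%:E = 0)%E.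
  suff : (fun k : nat => \int[P]_w ((Y w - Z w) ^+ 2)%:E)%E k @[k --> \oo] --> 0%E.
    by move/(cvg_lim (@ereal_hausdorff _)) <-; rewrite lim_cst.
  apply: (squeeze_cvge0 (C := 2) _ _ sY sZ) => k; first exact: ge0_sqint.
  by rewrite (sqintC P Z); exact: sqint_triangle.
have := sqint_eq0 (measurable_funB mY mZ) YZ0.
by apply: filterS => w /eqP; rewrite subr_eq0 => /eqP.
Qed.

Lemma wiener_integral_lincomb (f g : R -> R) (Y Z : Omega -> R) (c : R) :
  wiener_integral P W f Y -> wiener_integral P W g Z ->
  wiener_integral P W (fun x => f x + c * g x) (fun w => Y w + c * Z w).
Proof.
move=> [mf mY [s [ws sf sY]]] [mg mZ [t [wt tf tZ]]]; split.
- by apply: measurable_funD => //; exact: measurable_funM.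
- by apply: measurable_funD => //; exact: measurable_funM.
exists (fun k => s k ++ step_scale c (t k)); split.
- by move=> k; rewrite step_wf_cat step_wf_scale ws wt.
- have ct : ((c ^+ 2)%:E * \int[mu]_x ((g x - step_fun (t k) x) ^+ 2)%:E)%E @[k --> \oo] --> 0%E.
    by rewrite -[X in _ --> X](mule0 (c ^+ 2)%:E); exact: cvgeZl.
  apply: (squeeze_cvge0 (C := 2) _ _ sf ct) => k; first exact: ge0_sqint.
  have mf' : measurable_fun setT (fun x => f x - step_fun (s k) x).
    by apply: measurable_funB => //; exact: measurable_step_fun.
  have mg' : measurable_fun setT (fun x => g x - step_fun (t k) x).
    by apply: measurable_funB => //; exact: measurable_step_fun.
  rewrite -sqintZ//.
  have mcg : measurable_fun setT (fun x => c * (g x - step_fun (t k) x)).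
    exact: measurable_funM.
  apply: le_trans (sqintD_le mu mf' mcg).
  rewrite le_eqVlt; apply/orP; left; apply/eqP; apply: eq_integral => x _.
  by rewrite step_fun_cat step_fun_scale; congr (_ ^+ 2)%:E; ring.
- have ct : ((c ^+ 2)%:E * \int[P]_w ((Z w - step_integral W (t k) w) ^+ 2)%:E)%E @[k --> \oo] --> 0%E.
    by rewrite -[X in _ --> X](mule0 (c ^+ 2)%:E); exact: cvgeZl.
  apply: (squeeze_cvge0 (C := 2) _ _ sY ct) => k; first exact: ge0_sqint.
  have mZ' := measurable_funB mZ (mI (t k)).
  rewrite -sqintZ//.
  have mcZ : measurable_fun setT (fun w => c * (Z w - step_integral W (t k) w)).
    exact: measurable_funM.
  apply: le_trans (sqintD_le P (measurable_funB mY (mI (s k))) mcZ).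
  rewrite le_eqVlt; apply/orP; left; apply/eqP; apply: eq_integral => w _.
  by rewrite step_integral_cat step_integral_scale /=; congr (_ ^+ 2)%:E; ring.
Qed.

Lemma sqint_shift (f : R -> R) (s : step_data R) (r : R) : measurable_fun setT f ->
  (\int[mu]_x ((f (x - r) - step_fun (step_shift r s) x) ^+ 2)%:E =
   \int[mu]_x ((f x - step_fun s x) ^+ 2)%:E)%E.
Proof.
move=> mf; rewrite [RHS](ge0_integral_affine (a := 1) (- r))//.
- rewrite mul1e; apply: eq_integral => x _.
  by rewrite mul1r step_fun_shift.
- by apply: measurable_sqr; apply: measurable_funB => //; exact: measurable_step_fun.
- by move=> x; rewrite lee_fin sqr_ge0.
Qed.

Lemma step_integral_sqint_lty s : (\int[P]_w (step_integral W s w ^+ 2)%:E < +oo)%E.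
Proof.
elim: s => [|i s IH].
  rewrite (eq_integral (cst 0%E)) ?integral0 ?ltry// => w _.
  by rewrite /step_integral big_nil expr0n.
have mi : measurable_fun setT (fun w => i.1 * (W i.2.2 w - W i.2.1 w)).
  by apply: measurable_funM => //; exact: measurable_funB.
apply: (@le_lt_trans _ _ (2%:E * \int[P]_w ((i.1 * (W i.2.2 w - W i.2.1 w)) ^+ 2)%:E +
    2%:E * \int[P]_w ((step_integral W s w) ^+ 2)%:E)%E).
  under eq_integral do rewrite /step_integral big_cons.
  exact: (sqintD_le P mi (mI s)).
apply: lte_add_pinfty; rewrite lte_mul_pinfty ?lee_fin//.
rewrite sqintZ; last exact: measurable_funB.
by rewrite (wiener_increment_moment2 BW) -EFinM ltry.
Qed.

Lemma wiener_integral_sqint_lty f Y : wiener_integral P W f Y ->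
  (\int[P]_w (Y w ^+ 2)%:E < +oo)%E.
Proof.
move=> [mf mY [s [ws sf sY]]].
have [k _ /(_ k (leqnn _)) sk1] := cvge0_near_lt ltr01 sY.
apply: (@le_lt_trans _ _ (2%:E * \int[P]_w ((Y w - step_integral W (s k) w) ^+ 2)%:E +
    2%:E * \int[P]_w ((step_integral W (s k) w - 0) ^+ 2)%:E)%E).
  have := sqint_triangle P mY (mI (s k)) (measurable_cst (0 : R)).
  by under [X in (X <= _)%E -> _]eq_integral do rewrite /= subr0.
under [X in (_ + _ * X < _)%E]eq_integral do rewrite subr0.
apply: lte_add_pinfty; rewrite lte_mul_pinfty ?lee_fin//.
  exact: (lt_trans sk1 (ltry _)).
exact: step_integral_sqint_lty.
Qed.

End wiener_integrals.

(** * Stationarity of integrals of translated kernels *)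

Section stationary_integrals.
Context d (Omega : measurableType d) (R : realType) (P : probability Omega R).
Context (W : R -> Omega -> R) (BW : bilateral_wiener P W).
Notation mu := (@lebesgue_measure R).

Let mW := wiener_measurable BW.
Let mI s := measurable_step_integral s mW.

(** Translated step data approximate the translated integrand equally well. Using the same
    coefficients for both integrals makes them one functional of the increments and of the
    translated increments. *)
Lemma wiener_integral_shift_approx (f g : R -> R) (Y Z : Omega -> R) (r : R) :
  wiener_integral P W f Y -> wiener_integral P W g Z ->
  (forall x, g x = f (x - r)) ->
  exists s : nat -> step_data R,
    {ae P, forall w, step_integral W (s k) w @[k --> \oo] --> Y w} /\
    {ae P, forall w, step_integral W (step_shift r (s k)) w @[k --> \oo] --> Z w}.
Proof.
move=> fY gZ gf; have [mf mY [s [ws sf sY]]] := fY; have [_ mZ _] := gZ.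
have sZ : (\int[P]_w ((Z w - step_integral W (step_shift r (s k)) w) ^+ 2)%:E)%E
    @[k --> \oo] --> 0%E.
  apply: (wiener_integral_cvg BW gZ) => [k|]; first by rewrite step_wf_shift.
  rewrite (_ : (fun k => _) = fun k =>
    (\int[mu]_x ((f x - step_fun (s k) x) ^+ 2)%:E)%E)//.
  apply/funext => k; rewrite -(sqint_shift (s k) r mf).
  by apply: eq_integral => x _; rewrite gf.
(* A common subsequence with geometric errors upgrades both mean-square convergences to almost sure
   ones. *)
have /choice[phi phiP] : forall k, exists n,
    (\int[P]_w ((Y w - step_integral W (s n) w) ^+ 2)%:E <= (1 * 2^-1 ^+ k)%:E)%E /\
    (\int[P]_w ((Z w - step_integral W (step_shift r (s n)) w) ^+ 2)%:E <= (1 * 2^-1 ^+ k)%:E)%E.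
  move=> k; have e0 : 0 < 1 * 2^-1 ^+ k :> R by rewrite mul1r exprn_gt0.
  have [n _ H] := filterI (cvge0_near_lt e0 sY) (cvge0_near_lt e0 sZ).
  by have [/ltW ? /ltW ?] := H n (leqnn n); exists n.
have r01 : 0 < (2^-1 : R) < 1 by rewrite invr_gt0 invf_lt1 ?ltr0n// ltr1n.
exists (s \o phi); split.
- exact: (ae_cvg_geometric ler01 r01 mY (fun k => mI _) (fun k => (phiP k).1)).
- exact: (ae_cvg_geometric ler01 r01 mZ (fun k => mI _) (fun k => (phiP k).2)).
Qed.

Lemma stationary_wiener_integrals (K : R -> R -> R) (xi : R -> Omega -> R) (r : R) :
  (forall t, wiener_integral P W (K t) (xi t)) ->
  (forall t x, K (t + r) x = K t (x - r)) ->
  same_law P ((fun w t => xi t w) : Omega -> @pathspace R R)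
             ((fun w t => xi (t + r) w) : Omega -> @pathspace R R).
Proof.
move=> Kxi Kr.
have mxi t : measurable_fun setT (xi t) by have [] := Kxi t.
have /choice[s sP] := fun t => wiener_integral_shift_approx (Kxi t) (Kxi (t + r)) (Kr t).
(* The upper limit is defined and measurable on the whole path space, and equals the limit wherever
   the step integrals converge to a real number. *)
pose F (x : @pathspace R (R * R)%type) : @pathspace R R := fun t =>
  fine (limn_esup (fun k => (\sum_(i <- s t k) i.1 * x i.2)%:E)).
have mF : measurable_fun setT F.
  apply: measurable_to_path => t.
  have mk k : measurable_fun setT (fun x : @pathspace R (R * R)%type =>
      (\sum_(i <- s t k) i.1 * x i.2)%:E).
    apply/measurable_EFinP; apply: measurable_sum => i.
    by apply: measurable_funM => //; exact: measurable_eval.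
  exact: (measurableT_comp (fine_measurable measurableT) (measurable_fun_limn_esup mk)).
have FE (y : @pathspace R (R * R)%type) t l :
    (\sum_(i <- s t k) i.1 * y i.2) @[k --> \oo] --> l -> F y t = l.
  move=> H; rewrite /F.
  have [_ ->] : (limn_einf (fun k => (\sum_(i <- s t k) i.1 * y i.2)%:E) = l%:E) *
     (limn_esup (fun k => (\sum_(i <- s t k) i.1 * y i.2)%:E) = l%:E).
    by apply: cvg_limn_einf_sup; apply/fine_cvgP; split; [exact: nearW|exact: H].
  by [].
apply: (same_law_ae _ _ _ _ (same_law_comp mF (same_law_increments BW 0 r))).
- by apply: measurable_to_path => t; exact: mxi.
- by apply: measurable_to_path => t; exact: mxi.
- move=> t; have [H _] := sP t; apply: filterS H => w H; apply: FE.
  rewrite (_ : (fun k => _) = fun k => step_integral W (s t k) w)//.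
  by apply/funext => k; apply: eq_bigr => i _; rewrite /increments !addr0.
- move=> t; have [_ H] := sP t; apply: filterS H => w H; apply: FE.
  rewrite (_ : (fun k => _) = fun k => step_integral W (step_shift r (s t k)) w)//.
  by apply/funext => k; rewrite /step_integral big_map.
Qed.

End stationary_integrals.

(** * Random elements of H *)

Lemma Lfun2_sqint d (T : measurableType d) (R : realType)
    (mu : {measure set T -> \bar R}) (f : T -> R) :
  measurable_fun setT f -> (\int[mu]_x (f x ^+ 2)%:E < +oo)%E ->
  f \in Lfun mu 2%:E.
Proof.
move=> mf f2; apply/andP; split; rewrite inE//=; rewrite /finite_norm.
have E : ('N[mu]_2[EFin \o f] `^ 2 = \int[mu]_x (f x ^+ 2)%:E)%E.
  rewrite powR_Lnorm//; apply: eq_integral => x _ /=.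
  by rewrite powR_mulrn// real_normK// num_real.
rewrite ltNge; apply/negP; rewrite leye_eq => /eqP oo.
by move: f2; rewrite -E oo poweRyr ?ltxx// pnatr_eq0.
Qed.

Section spaceH_theory.
Context {R : realType} (h : R).
Hypothesis h0 : 0 < h.
Notation mu := (@lebesgue_measure R).
Notation H := (spaceH h).
Implicit Types (f g : R -> R) (x y : H).

Let mE : measurable (`[0, h] : set (measurableTypeR R)).
Proof. exact: measurable_itv. Qed.

Lemma ge0_integral_muH (g : R -> \bar R) :
  measurable_fun setT g -> (forall t, 0 <= g t)%E ->
  (\int[muH h]_t g t = \int[mu]_(t in `[0%R, h]) g t + g h)%E.
Proof.
move=> mg g0; rewrite ge0_integral_measure_add//; congr (_ + _)%E.
- rewrite (@ge0_negligible_integral _ _ _ _ _ (~` `[0, h] : set (measurableTypeR R))) //=.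
  + rewrite setTD setCK.
    by apply: eq_measure_integral => /= A mA Ah; rewrite /mrestr setIidl.
  + exact: measurableC.
  + by rewrite /mrestr setICl measure0.
- by rewrite integral_dirac// diracT mul1e.
Qed.

Lemma in_itv0h : h \in `[0, h]%classic.
Proof. by rewrite inE/= in_itv/= lexx ltW. Qed.

Lemma measurable_restrict_itv f : measurable_fun `[0, h] f ->
  measurable_fun setT (f \_ `[0, h]).
Proof. by move=> mf; apply/(measurable_restrictT _ _).1. Qed.

Lemma integral_muH_restrict f : measurable_fun `[0, h] f ->
  (\int[muH h]_t (((f \_ `[0, h]) t) ^+ 2)%:E =
   \int[mu]_(t in `[0%R, h]) (f t ^+ 2)%:E + (f h ^+ 2)%:E)%E.
Proof.
move=> mf; rewrite ge0_integral_muH.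
- congr (_ + _)%E; last by rewrite patchE in_itv0h.
  by apply: eq_integral => t th; rewrite patchE th.
- by apply/measurable_EFinP; apply: measurable_funX; exact: measurable_restrict_itv.
- by move=> t; rewrite lee_fin sqr_ge0.
Qed.

Lemma in_H_bounded f M : measurable_fun `[0, h] f ->
  (forall t, 0 <= t <= h -> `|f t| <= M) -> in_H h f.
Proof.
move=> mf fM; apply: Lfun2_sqint; first exact: measurable_restrict_itv.
rewrite integral_muH_restrict//.
apply: (@le_lt_trans _ _ ((M ^+ 2)%:E * mu `[0%R, h]%classic + (M ^+ 2)%:E)%E).
  apply: leeD.
    rewrite -integral_cst//; apply: ge0_le_integral => //.
    - by move=> t _; rewrite lee_fin sqr_ge0.
    - by apply/measurable_EFinP; exact: measurable_funX.
    - move=> t; rewrite /= in_itv/= => th; rewrite lee_fin -[leLHS]real_normK ?num_real//.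
      by rewrite lerXn2r// ?nnegrE// ?(le_trans _ (fM _ th)) ?fM.
  have hh : 0 <= h <= h by rewrite lexx ltW.
  rewrite lee_fin -[leLHS]real_normK ?num_real//.
  by rewrite lerXn2r// ?nnegrE// ?(le_trans _ (fM _ hh)) ?fM.
by rewrite lebesgue_measure_itv/= lte_fin h0 -EFinB -EFinM -EFinD ltry.
Qed.

Lemma in_H_measurable f : in_H h f -> measurable_fun `[0, h] f.
Proof.
move=> /andP[]; rewrite inE => mf _.
by apply/(measurable_restrictT _ _).2.
Qed.

Lemma in_HD f g : in_H h f -> in_H h g -> in_H h (fun t => f t + g t).
Proof.
rewrite /in_H => fH gH.
have -> : (fun t => f t + g t) \_ `[0, h] = f \_ `[0, h] + g \_ `[0, h].
  by apply/funext => t; rewrite -[RHS]/(_ t + _ t) !patchE; case: ifP; rewrite ?addr0.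
exact: ((Lfun_addr_closed (muH h) (@lee1n R 2)).2 _ _ fH gH).
Qed.

Lemma in_HZ c f : in_H h f -> in_H h (fun t => c * f t).
Proof.
rewrite /in_H => fH.
have -> : (fun t => c * f t) \_ `[0, h] = c \o* (f \_ `[0, h]).
  by apply/funext => t; rewrite /= !patchE mulrC; case: ifP; rewrite ?mul0r ?mulr0 1?mulrC.
by apply: Lfun_scale => //; rewrite ler1n.
Qed.

Definition L2of f : LfunType (muH h) (@lee1n R 2) :=
  insubd (0 : LfunType (muH h) (@lee1n R 2)) (f \_ `[0, h]).

Lemma L2ofE f : in_H h f -> L2of f = f \_ `[0, h] :> (R -> R).
Proof. by move=> fH; exact: (insubdK (0 : LfunType (muH h) (@lee1n R 2)) fH). Qed.

Lemma toH_pi f : toH h f = L2pi (L2of f).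
Proof. by []. Qed.

Lemma toHD f g : in_H h f -> in_H h g ->
  toH h (fun t => f t + g t) = toH h f + toH h g.
Proof.
move=> fH gH; rewrite !toH_pi -L2piD; congr L2pi; apply/LfuneqP => t.
rewrite [RHS](_ : _ = L2of f t + L2of g t)// !L2ofE//; last exact: in_HD.
by rewrite !patchE; case: ifP; rewrite ?addr0.
Qed.

Lemma toHZ c f : in_H h f -> toH h (fun t => c * f t) = c *: toH h f.
Proof.
move=> fH; rewrite !toH_pi [RHS]L2scale_pi; congr L2pi; apply/LfuneqP => t.
rewrite [RHS](_ : _ = c * L2of f t)// !L2ofE//; last exact: in_HZ.
by rewrite !patchE; case: ifP; rewrite ?mulr0.
Qed.

Lemma toHB f g : in_H h f -> in_H h g ->
  toH h (fun t => f t - g t) = toH h f - toH h g.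
Proof.
move=> fH gH; rewrite -scaleN1r -toHZ// -toHD//; last exact: in_HZ.
by congr toH; apply/funext => t; rewrite mulN1r.
Qed.

Lemma eq_toH f g : (forall t, 0 <= t <= h -> f t = g t) -> toH h f = toH h g.
Proof.
move=> fg; rewrite /toH; congr (L2class _ _); apply/funext => t; rewrite !patchE.
by case: ifPn => // /[!inE]/=; rewrite in_itv/= => /fg.
Qed.

Lemma measurable_L2rep x : measurable_fun setT (L2rep x).
Proof.
pose f : LfunType (muH h) (@lee1n R 2) := repr x.
by rewrite -[L2rep x]/(f : R -> R); exact: measurable_funP.
Qed.

Lemma norm_toH f : in_H h f -> (`|toH h f| ^+ 2)%:E =
  (\int[mu]_(t in `[0%R, h]) (f t ^+ 2)%:E + (f h ^+ 2)%:E)%E.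
Proof.
move=> fH; have mf := in_H_measurable fH.
rewrite -integral_muH_restrict// normHE -ge0_integral_muH; last 2 first.
- by apply/measurable_EFinP; apply: measurable_funX; exact: measurable_L2rep.
- by move=> t; rewrite lee_fin sqr_ge0.
apply: ae_eq_integral => //.
- by apply/measurable_EFinP; apply: measurable_funX; exact: measurable_L2rep.
- by apply/measurable_EFinP; apply: measurable_funX; exact: measurable_restrict_itv.
have := L2repr_pi (L2of f); rewrite -toH_pi.
by apply: filterS => t; rewrite L2ofE// /L2rep => ->.
Qed.

(** The point h has mass at least 1, so no null set contains it. *)
Lemma ae_muH_at (Q : R -> Prop) : {ae muH h, forall t, Q t} -> Q h.
Proof.
case=> A [mA muA] sub; apply: contrapT => /sub Ah; have := muA.
rewrite /muH/= /measure_add/= /msum !big_ord_recr/= big_ord0 add0e.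
rewrite diracE mem_set// => /eqP.
by rewrite gt_eqF// (@lt_le_trans _ _ 1%E)// leeDr.
Qed.

Lemma evalh_pi (f : LfunType (muH h) (@lee1n R 2)) :
  evalh (L2pi f : H) = f h.
Proof. exact: (ae_muH_at (L2repr_pi f)). Qed.

Lemma evalhD x y : evalh (x + y) = evalh x + evalh y.
Proof. by rewrite -(L2reprK x) -(L2reprK y) -L2piD !evalh_pi. Qed.

Lemma evalhZ c x : evalh (c *: x) = c * evalh x.
Proof. by rewrite -(L2reprK x) [_ *: _]L2scale_pi !evalh_pi. Qed.

Lemma evalhB x y : evalh (x - y) = evalh x - evalh y.
Proof. by rewrite evalhD -(scaleN1r y) evalhZ mulN1r. Qed.

(** The Dirac mass contributes the square of the value at h to the squared norm; this is what makes
    [rhoH] bounded. *)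
Lemma evalh_norm x : `|evalh x| <= `|x|.
Proof.
rewrite -(@ler_pXn2r _ 2)// ?nnegrE// -lee_fin normHE real_normK ?num_real//.
by rewrite leeDr// integral_ge0// => t _; rewrite lee_fin sqr_ge0.
Qed.

End spaceH_theory.

Section rho.
Context {R : realType} (h theta : R).
Hypothesis h0 : 0 < h.
Notation H := (spaceH h).

Lemma in_H_continuous (f : R -> R) : {within `[0, h], continuous f} -> in_H h f.
Proof.
move=> cf; have mf : measurable_fun `[0, h] f.
  by apply: subspace_continuous_measurable_fun => //; exact: measurable_itv.
have [M [_ HM]] := compact_bounded (continuous_compact cf (@segment_compact _ 0 h)).
apply: (in_H_bounded h0 mf (M := M + 1)) => t th; apply: (HM (M + 1)); first by rewrite ltrDl.
by exists t => //=; rewrite in_itv.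
Qed.

Definition rho_vec : H := toH h (fun t => expR (- theta * t)).

Lemma in_H_expR : in_H h (fun t => expR (- theta * t)).
Proof.
apply: in_H_continuous; apply: continuous_subspaceT => t.
apply: continuous_comp; last exact: continuous_expR.
by apply: cvgM; [exact: cvg_cst|exact: cvg_id].
Qed.

Lemma rhoHE (x : H) : rhoH theta x = evalh x *: rho_vec.
Proof.
rewrite /rhoH /rho_vec -toHZ//; last exact: in_H_expR.
by congr toH; apply/funext => t; rewrite mulrC.
Qed.

Lemma bounded_rhoH : bounded_operator (rhoH theta : H -> H).
Proof.
split; first by move=> a x y; rewrite !rhoHE evalhD// evalhZ// scalerDl scalerA.
exists `|rho_vec| => x; rewrite rhoHE normrZ mulrC ler_wpM2l// evalh_norm//.
Qed.

Lemma evalh_rhoH (x : H) : evalh (rhoH theta x) = expR (- theta * h) * evalh x.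
Proof.
have E : evalh rho_vec = expR (- theta * h) := evalh_toH (ltW h0) in_H_expR.
by rewrite rhoHE evalhZ E mulrC.
Qed.

Lemma iter_rhoH k (x : H) :
  iter k.+1 (rhoH theta) x = (expR (- theta * h) ^+ k * evalh x) *: rho_vec.
Proof.
rewrite iterS rhoHE; congr (_ *: _).
by elim: k => [|k IH]; rewrite ?mul1r// iterS evalh_rhoH IH exprS mulrA.
Qed.

End rho.

(** * Discretised paths and Borel sets of H *)

Section discretisation.
Context {R : realType} (h : R).
Hypothesis h0 : 0 < h.
Notation mu := (@lebesgue_measure R).
Notation H := (spaceH h).

(* Path values are rounded to multiples of 1 / (k + 1), so that the discretised
   path takes countably many values and no measurability of V is required in
   [measurable_disc_toH]. *)
Definition stepv (k : nat) (c : nat -> int) (t : R) : R :=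
  (c (Num.truncn (t * k.+1%:R / h)))%:~R / k.+1%:R.

Definition disc_coef (k : nat) (x : R -> R) (j : nat) : int :=
  Num.floor (k.+1%:R * x (h * j%:R / k.+1%:R)).

Lemma measurable_truncn (c : nat -> R) : measurable_fun setT (fun t : R => c (Num.truncn t)).
Proof.
move=> _ B mB; rewrite setTI.
have -> : (fun t : R => c (Num.truncn t)) @^-1` B =
    \bigcup_(n in [set n | B (c n)])
      ([set t | Num.truncn t = n]).
  apply/seteqP; split => t /=; first by exists (Num.truncn t).
  by move=> [n Bn ->].
apply: bigcup_measurable => n _.
have m1 k : measurable [set t : R | (Num.truncn t <= k)%N].
  have -> : [set t : R | (Num.truncn t <= k)%N] = `]-oo, k.+1%:R[%classic.
    by apply/seteqP; split => t /=; rewrite in_itv/= truncn_le_nat.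
  exact: measurable_itv.
case: n => [|n].
  rewrite (_ : [set t | _] = [set t : R | (Num.truncn t <= 0)%N])//.
  by apply/seteqP; split => t /=; rewrite leqn0 => /eqP.
rewrite (_ : [set t | _] = [set t : R | (Num.truncn t <= n.+1)%N] `\`
    [set t : R | (Num.truncn t <= n)%N]); first exact: measurableD.
apply/seteqP; split => t /=; first by move=> ->; rewrite leqnn ltnn.
by move=> [a /negP]; rewrite -ltnNge => b; apply/eqP; rewrite eqn_leq a b.
Qed.

Lemma measurable_stepv k c : measurable_fun setT (stepv k c).
Proof.
rewrite /stepv; apply: (measurableT_comp (measurable_truncn (fun j => (c j)%:~R / k.+1%:R))).
by apply: measurable_funM => //; exact: measurable_funM.
Qed.

(** The index k + 1 is attained at t = h only; as h is an atom it cannot be dropped, which gives k +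
    2 coefficients. *)
Lemma truncn_grid k t : 0 <= t <= h -> (Num.truncn (t * k.+1%:R / h) < k.+2)%N.
Proof.
move=> /andP[t0 th]; rewrite ltnS truncn_le_nat.
apply: (@le_lt_trans _ _ k.+1%:R); last by rewrite ltr_nat.
by rewrite ler_pdivrMr// mulrC ler_wpM2l.
Qed.

Lemma in_H_stepv k c : in_H h (stepv k c).
Proof.
pose M : R := \sum_(j < k.+2) `|(c j)%:~R / k.+1%:R|.
apply: (in_H_bounded h0 (M := M)).
  by apply: (measurable_funS measurableT) => //; exact: measurable_stepv.
move=> t th; have jk := truncn_grid k th.
rewrite /M (bigD1 (Ordinal jk))//= /stepv lerDl.
by apply: sumr_ge0.
Qed.

Lemma eq_toH_stepv k c c' : (forall j, (j < k.+2)%N -> c j = c' j) ->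
  toH h (stepv k c) = toH h (stepv k c').
Proof.
by move=> cc'; apply: eq_toH => t th; rewrite /stepv cc'//; exact: truncn_grid.
Qed.

Lemma measurable_disc_toH k (V : set H) :
  measurable [set x : @pathspace R R | V (toH h (stepv k (disc_coef k x)))].
Proof.
(* The class depends on a vector of k + 2 integers only. Such vectors form a countable type, so the
   event is a countable union of events that fix the vector. *)
pose ext (c : {ffun 'I_k.+2 -> int}) (j : nat) : int :=
  if insub j is Some i then c i else 0.
pose A (c : {ffun 'I_k.+2 -> int}) : set (@pathspace R R) :=
  [set x | V (toH h (stepv k (ext c))) /\ forall j : 'I_k.+2, disc_coef k x j = c j].
rewrite (_ : [set x | _] = \bigcup_c A c).
  apply: countable_bigcupT_measurable; first exact: countableP.
  move=> c; rewrite /A.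
  have [Vc|nVc] := pselect (V (toH h (stepv k (ext c)))); last first.
    by rewrite (_ : [set x | _] = set0)//; apply/seteqP; split => x // [].
  rewrite (_ : [set x | _] = \bigcap_(j in [set: 'I_k.+2])
      [set x : @pathspace R R | disc_coef k x j = c j]); last first.
    by apply/seteqP; split => [x [_ xc] j _|x xc]; [exact: xc|split => // j; exact: xc].
  apply: fin_bigcap_measurable => // j _.
  rewrite (_ : [set x | _] = (fun x : @pathspace R R => k.+1%:R * x (h * j%:R / k.+1%:R)) @^-1`
      `[(c j)%:~R, (c j + 1)%:~R[%classic); last first.
    apply/seteqP; split => x /=; rewrite in_itv/= /disc_coef.
      by move=> <-; exact: floor_itv.
    by move=> H'; apply/eqP; rewrite floor_eq.
  rewrite -[X in measurable X]setTI.
  have mj : measurable_fun setT (fun x : @pathspace R R => k.+1%:R * x (h * j%:R / k.+1%:R)).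
    by apply: measurable_funM => //; exact: measurable_eval.
  exact: mj.
have extE x j : (j < k.+2)%N -> disc_coef k x j = ext [ffun i : 'I_k.+2 => disc_coef k x i] j.
  by move=> jk; rewrite /ext insubT ffunE.
apply/seteqP; split => x /=.
  move=> Vx; exists [ffun i : 'I_k.+2 => disc_coef k x i] => //; split.
    by rewrite -(eq_toH_stepv (c := disc_coef k x))// => j jk; exact: extE.
  by move=> j; rewrite ffunE.
move=> [c _ [Vc xc]]; rewrite (eq_toH_stepv (c' := ext c))// => j jk.
by rewrite (extE x j jk) /ext insubT ffunE xc.
Qed.

End discretisation.

Section discretisation_cvg.
Context {R : realType} (h : R).
Hypothesis h0 : 0 < h.
Notation mu := (@lebesgue_measure R).
Notation H := (spaceH h).

Definition grid (k : nat) (t : R) : R :=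
  h * (Num.truncn (t * k.+1%:R / h))%:R / k.+1%:R.

Lemma grid_dist k t : 0 <= t ->
  t - h * @harmonic R k <= grid k t <= t.
Proof.
move=> t0; rewrite /grid /harmonic/=.
have a0 : 0 <= t * k.+1%:R / h by rewrite divr_ge0 ?mulr_ge0// ltW.
have /andP[jt tj] := truncn_itv a0.
set j := Num.truncn _ in jt tj *.
have k0 : 0 < k.+1%:R :> R by rewrite ltr0n.
apply/andP; split.
  rewrite lerBlDr -mulrDl ler_pdivlMr//.
  by move: tj; rewrite ltr_pdivrMr// -natr1; lra.
by rewrite ler_pdivrMr// mulrC; move: jt; rewrite ler_pdivlMr.
Qed.

Lemma stepv_dist k (x : R -> R) t :
  x (grid k t) - @harmonic R k <= stepv h k (disc_coef h k x) t <= x (grid k t).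
Proof.
rewrite /stepv /disc_coef -/(grid k t) /harmonic/=.
have k0 : 0 < k.+1%:R :> R by rewrite ltr0n.
have /andP[fl fg] := floor_itv (k.+1%:R * x (grid k t)).
apply/andP; split; last by rewrite ler_pdivrMr//; move: fl; lra.
rewrite lerBlDr -[X in _ <= _ + X]mul1r -mulrDl ler_pdivlMr//.
move: fg; rewrite intrD; lra.
Qed.

Lemma cvg_grid t : 0 <= t -> grid k t @[k --> \oo] --> t.
Proof.
move=> t0; apply: (@squeeze_cvgr _ _ _ _ (fun k => t - h * @harmonic R k) (fun=> t)).
- by apply: nearW => k; exact: grid_dist.
- rewrite -[X in _ --> X]subr0 -(mulr0 h); apply: cvgB; first exact: cvg_cst.
  by apply: cvgM; [exact: cvg_cst|exact: cvg_harmonic].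
- exact: cvg_cst.
Qed.

Lemma cvg_stepv (x : R -> R) t : 0 <= t -> continuous x ->
  stepv h k (disc_coef h k x) t @[k --> \oo] --> x t.
Proof.
move=> t0 cx; have xg : x (grid k t) @[k --> \oo] --> x t.
  by apply: (cvg_comp _ _ (cvg_grid t0)); exact: cx.
apply: (@squeeze_cvgr _ _ _ _ (fun k => x (grid k t) - @harmonic R k) (fun k => x (grid k t))).
- by apply: nearW => k; exact: stepv_dist.
- by rewrite -[X in _ --> X]subr0; apply: cvgB => //; exact: cvg_harmonic.
- exact: xg.
Qed.

(** Dominated convergence handles the Lebesgue part of the norm, and pointwise convergence at h the
    atom. *)
Lemma cvg_toH_stepv (x : R -> R) : continuous x ->
  toH h (stepv h k (disc_coef h k x)) @[k --> \oo] --> toH h x.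
Proof.
move=> cx; have xH : in_H h x by apply: in_H_continuous => //; exact: continuous_subspaceT.
have [M [Mr HM]] := compact_bounded (continuous_compact (continuous_subspaceT cx) (@segment_compact _ 0 h)).
have {}HM t : 0 <= t <= h -> `|x t| <= M + 1.
  by move=> th; apply: (HM (M + 1)); rewrite ?ltrDl//; exists t => //=; rewrite in_itv.
pose f k (t : R) : R := stepv h k (disc_coef h k x) t - x t.
have fH k : in_H h (f k).
  rewrite (_ : f k = fun t => stepv h k (disc_coef h k x) t + (-1) * x t).
    by apply: in_HD; [exact: in_H_stepv|exact: in_HZ].
  by apply/funext => t; rewrite mulN1r.
have f0 t : 0 <= t <= h -> f k t @[k --> \oo] --> 0.
  move=> /andP[t0 _]; rewrite -(subrr (x t)); apply: cvgB; last exact: cvg_cst.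
  exact: cvg_stepv.
have f20 t : 0 <= t <= h -> (f k t ^+ 2)%:E @[k --> \oo] --> 0%E.
  move=> th; apply: cvg_EFin; first exact: nearW.
  rewrite -(mulr0 0); under eq_fun do rewrite /= expr2; by apply: cvgM; exact: f0.
(* M + 1 bounds the path both at t and at its grid point, and the rounding error is at most 1. *)
have fM k t : 0 <= t <= h -> `|f k t| <= 2 * (M + 1) + 1.
  move=> th; have /andP[t0 tle] := th.
  have /andP[g1 g2] := stepv_dist k x t.
  have /andP[gt1 gt2] := grid_dist k t0.
  have gth : 0 <= grid k t <= h.
    rewrite (le_trans gt2 tle) andbT /grid divr_ge0// mulr_ge0//; exact: ltW.
  have := HM _ gth; have := HM _ th; rewrite !ler_norml => /andP[a1 a2] /andP[b1 b2].
  have hk : @harmonic R k <= 1 by rewrite /harmonic/= invf_le1// ler1n.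
  rewrite /f; apply/andP; split; lra.
have nf k : (`|toH h (stepv h k (disc_coef h k x)) - toH h x| ^+ 2)%:E =
    (\int[mu]_(t in `[0%R, h]) (f k t ^+ 2)%:E + (f k h ^+ 2)%:E)%E.
  by rewrite -toHB//; [exact: (norm_toH h0 (fH k))|exact: in_H_stepv].
have mh : measurable (`[0, h] : set (measurableTypeR R)) by exact: measurable_itv.
have int0 : (\int[mu]_(t in `[0%R, h]) (f k t ^+ 2)%:E)%E @[k --> \oo] --> 0%E.
  have [] := @dominated_convergence _ _ _ mu `[0, h] mh (fun k t => (f k t ^+ 2)%:E)
    (cst 0%E) (cst ((2 * (M + 1) + 1) ^+ 2)%:E).
  - move=> k; apply/measurable_EFinP; apply: measurable_funX.
    exact: (in_H_measurable (fH k)).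
  - exact: measurable_cst.
  - by apply: aeW => t; rewrite /= in_itv/= => /f20.
  - apply/integrableP; split; first exact: measurable_cst.
    rewrite integral_cst//= lebesgue_measure_itv/= lte_fin h0 -EFinB -EFinM ltry//.
  - apply: aeW => t k; rewrite /= in_itv/= => th.
    rewrite lee_fin ger0_norm ?sqr_ge0// -[leLHS]real_normK ?num_real//.
    by rewrite lerXn2r// ?nnegrE ?fM// (le_trans _ (fM k _ th)).
  by move=> _ _; rewrite integral_cst// mul0e.
apply/cvgrPdist_lt => e e0.
have e20 : 0 < e ^+ 2 by rewrite exprn_gt0.
have hh : 0 <= h <= h by rewrite lexx ltW.
pose u k := (`|toH h (stepv h k (disc_coef h k x)) - toH h x| ^+ 2)%:E.
have u0 : u k @[k --> \oo] --> 0%E.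
  have -> : u = fun k =>
      (\int[mu]_(t in `[0%R, h]) (f k t ^+ 2)%:E + (f k h ^+ 2)%:E)%E by exact/funext.
  rewrite -[X in _ --> X]adde0; apply: cvgeD; [by []|exact: int0|exact: f20].
have := cvge0_near_lt e20 u0; apply: filterS => k.
rewrite lte_fin distrC => He.
by rewrite -(@ltr_pXn2r _ 2)// ?nnegrE ?normr_ge0 // ltW.
Qed.

(* No separability of H is needed: for U open, [U (toH h x)] is a countable
   combination of the events of [measurable_disc_toH]. *)
Lemma toH_measurable (B : set H) : borel_set B ->
  exists2 C : set (@pathspace R R), measurable C &
    forall x : R -> R, continuous x -> (B (toH h x) <-> C x).
Proof.
apply: (smallest_sub (X := [set B : set H | exists2 C : set (@pathspace R R), measurable C &
    forall x : R -> R, continuous x -> (B (toH h x) <-> C x)])).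
  split.
  - by exists set0.
  - move=> A [C mC AC]; exists (~` C); first exact: measurableC.
    by move=> x cx; have := AC x cx; rewrite /setD/=; tauto.
  - move=> F HF.
    have /choice[C CP] : forall i, exists C : set (@pathspace R R),
        measurable C /\ forall x : R -> R, continuous x -> (F i (toH h x) <-> C x).
      by move=> i; have [C mC HC] := HF i; exists C.
    exists (\bigcup_i C i); first by apply: bigcupT_measurable => i; exact: (CP i).1.
    by move=> x cx; split => -[i _ /((CP i).2 x cx) Fi]; exists i.
move=> U /= oU.
(* These are the points of U with a margin. A limit of points of U may leave U, but a limit of
   points of [Um m], for a fixed m, stays in U; conversely, if the limit is in U, the approximants
   eventually lie in some [Um m]. *)
pose Um m := [set y : H | forall z, `|z - y| < @harmonic R m -> U z].
pose D k m := [set x : @pathspace R R | Um m (toH h (stepv h k (disc_coef h k x)))].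
exists (\bigcup_m \bigcup_K \bigcap_(k in [set k | (K <= k)%N]) D k m).
  apply: bigcupT_measurable => m; apply: bigcupT_measurable => K.
  by apply: bigcap_measurableType => k _; exact: measurable_disc_toH.
move=> x cx; have /cvgrPdist_lt yk := cvg_toH_stepv cx; split.
- move=> Ux; have : nbhs (toH h x) U by exact: open_nbhs_nbhs.
  move=> /nbhs_ballP[e /= e0 eU].
  have : \forall m \near \oo, @harmonic R m < e / 2.
    have /cvgrPdist_lt := @cvg_harmonic R; move=> /(_ (e / 2)); rewrite divr_gt0// => /(_ isT).
    by apply: filterS => m; rewrite sub0r normrN ger0_norm// /harmonic/= invr_ge0.
  move=> [m _ /(_ m (leqnn m)) me].
  have [K _ HK] := yk (e / 2) (divr_gt0 e0 (ltr0n _ 2)).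
  exists m => //; exists K => // k /= Kk z zy; apply: eU.
  rewrite -ball_normE/= (le_lt_trans (ler_distD (toH h (stepv h k (disc_coef h k x))) _ _))//.
  rewrite [ltRHS](splitr e) ltrD//; first exact: HK.
  by rewrite distrC (lt_trans zy).
- move=> [m _ [K _ HK]].
  have hm : 0 < @harmonic R m by rewrite /harmonic/= invr_gt0.
  have [N _ HN] := yk _ hm.
  apply: (HK (maxn K N)); first exact: leq_maxl.
  by apply: HN => /=; exact: leq_maxr.
Qed.

End discretisation_cvg.

(** * Measurability and second moments of classes of paths *)

Section random_elements.
Context d (Omega : measurableType d) (R : realType) (P : probability Omega R).

Lemma borel_set_preimage_open (H : normedModType R) (g : H -> R) (B : set R) :
  continuous g -> measurable B -> borel_set (g @^-1` B).
Proof.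
move=> /continuousP cg.
pose G := [set B : set R | borel_set (g @^-1` B)].
suff : (@measurable _ (measurableTypeR R)) `<=` G by apply.
rewrite RGenOpens.measurableE.
apply: smallest_sub.
  split; rewrite /G/=.
  - by rewrite preimage_set0; exact: sigma_algebra0.
  - by move=> A GA; rewrite setTD preimage_setC; exact: sigma_algebraC.
  - by move=> F GF; rewrite preimage_bigcup; exact: sigma_algebra_bigcup.
move=> _ [a [b ->]]; apply: sub_sigma_algebra; apply: cg; exact: interval_open.
Qed.

Lemma measurable_continuous_comp (H : normedModType R) (Y : Omega -> H) (g : H -> R) :
  random_element Y -> continuous g -> measurable_fun setT (fun w => g (Y w)).
Proof.
by move=> rY cg _ B mB; rewrite setTI; apply: (rY (g @^-1` B)); exact: borel_set_preimage_open.
Qed.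

Context (h : R).
Hypothesis h0 : 0 < h.
Notation mu := (@lebesgue_measure R).
Notation H := (spaceH h).

Lemma random_element_toH (Z : R -> Omega -> R) :
  (forall t, measurable_fun setT (Z t)) -> (forall w, continuous (fun t => Z t w)) ->
  random_element (fun w => toH h (fun t => Z t w)).
Proof.
move=> mZ cZ B /(toH_measurable h0)[C mC BC].
have -> : (fun w => toH h (fun t => Z t w)) @^-1` B =
    ((fun w t => Z t w) : Omega -> @pathspace R R) @^-1` C.
  by apply/seteqP; split => w /=; move: (BC _ (cZ w)) => [? ?].
rewrite -[X in measurable X]setTI; apply: measurable_to_path mC => //.
Qed.

(** Joint measurability, required by Tonelli's theorem: the process is the limit of its values at
    grid points, which are piecewise constant in time. Negative times are sent to 0 because
    [cvg_grid] holds for nonnegative times. *)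
Lemma measurable_process (Z : R -> Omega -> R) :
  (forall t, measurable_fun setT (Z t)) -> (forall w, continuous (fun t => Z t w)) ->
  measurable_fun setT (fun z : Omega * measurableTypeR R => Z (Num.max 0 z.2) z.1).
Proof.
move=> mZ cZ.
pose Zk k (z : Omega * measurableTypeR R) := Z (grid h k (Num.max 0 z.2)) z.1.
apply: (@measurable_fun_cvg _ _ R setT Zk); last first.
  move=> [w t] _; rewrite /Zk/=.
  have t0 : 0 <= Num.max 0 t by rewrite le_max lexx.
  exact: (cvg_comp _ (fun s => Z s w) (cvg_grid h0 t0) (cZ w _)).
move=> k _ B mB; rewrite setTI.
pose T j : set (measurableTypeR R) := [set t : R | Num.truncn (Num.max 0 t * k.+1%:R / h) = j].
have mT j : measurable (T j).
  have m1 : measurable_fun setT (fun t : R => (Num.truncn t)%:R : R) :=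
    measurable_truncn (fun j => j%:R).
  have m2 : measurable_fun setT (fun t : R => Num.max 0 t * k.+1%:R / h).
    apply: measurable_funM => //; apply: measurable_funM => //.
    by apply: measurable_maxr.
  have m3 := measurableT_comp m1 m2.
  have := m3 measurableT [set j%:R] (measurable_set1 _).
  rewrite setTI; congr measurable; apply/seteqP; split => t /=.
    by move=> /eqP; rewrite eqr_nat => /eqP.
  by move=> ->.
rewrite (_ : Zk k @^-1` B = \bigcup_j ((Z (h * j%:R / k.+1%:R) @^-1` B) `*` T j)).
  apply: bigcupT_measurable => j; apply: measurableX => //.
  by rewrite -[X in measurable X]setTI; exact: mZ.
apply/seteqP; split => [[w t]|[w t] [j _ [Bj Tj]]] /=.
  by move=> BZ; exists (Num.truncn (Num.max 0 t * k.+1%:R / h)).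
by move: Bj Tj; rewrite /T /Zk /grid/= => Bj ->.
Qed.

(** By Tonelli's theorem the Lebesgue part contributes C h; the atom contributes C. *)
Lemma sqint_norm_toH_le (Z : R -> Omega -> R) (C : R) :
  (forall t, measurable_fun setT (Z t)) -> (forall w, continuous (fun t => Z t w)) ->
  (forall t, 0 <= t <= h -> (\int[P]_w (Z t w ^+ 2)%:E <= C%:E)%E) ->
  (\int[P]_w (`|toH h (fun t => Z t w)| ^+ 2)%:E <= (C * h + C)%:E)%E.
Proof.
move=> mZ cZ ZC.
have ZH w : in_H h (fun t => Z t w).
  by apply: in_H_continuous => //; exact: continuous_subspaceT.
have mh : measurable (`[0, h] : set (measurableTypeR R)) by exact: measurable_itv.
pose f (z : Omega * measurableTypeR R) : \bar R :=
  ((Z (Num.max 0 z.2) z.1 ^+ 2) * \1_(`[0, h]) z.2)%:E.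
have mf : measurable_fun setT f.
  apply/measurable_EFinP; apply: measurable_funM.
    by apply: measurable_funX; exact: measurable_process.
  have m1 : measurable_fun setT (\1_(`[0, h]) : measurableTypeR R -> R).
    exact: measurable_indic.
  exact: (measurableT_comp m1 (@measurable_snd _ _ Omega (measurableTypeR R))).
have f0 z : (0 <= f z)%E by rewrite lee_fin mulr_ge0// sqr_ge0.
have fE w : (\int[mu]_(t in `[0%R, h]) (Z t w ^+ 2)%:E = \int[mu]_t f (w, t))%E.
  rewrite integral_mkcond; apply: eq_integral => t _.
  rewrite patchE /f/= indicE; case: ifPn => [|_]; last by rewrite mulr0.
  by rewrite inE/= in_itv/= => /andP[t0 _]; rewrite mulr1 max_r.
under eq_integral do rewrite norm_toH// fE.
have mZh : measurable_fun setT (fun w => (Z h w ^+ 2)%:E) by exact: measurable_sqr.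
rewrite ge0_integralD//; last 3 first.
- by move=> w _; apply: integral_ge0 => t _.
- exact: (@measurable_fun_fubini_tonelli_F _ _ Omega (measurableTypeR R) R mu f mf f0).
- by move=> w _; rewrite lee_fin sqr_ge0.
rewrite (fubini_tonelli (m1 := P) (m2 := mu) f mf f0).
rewrite EFinD; apply: leeD; last by apply: ZC; rewrite lexx ltW.
have gE t : (\int[P]_w f (w, t) =
    if t \in `[0%R, h]%classic then \int[P]_w (Z t w ^+ 2)%:E else 0)%E.
  rewrite /f/= indicE; case: ifPn => tin.
    move: tin; rewrite inE/= in_itv/= => /andP[t0 _].
    by apply: eq_integral => w _; rewrite mulr1 max_r.
  by rewrite -[RHS](integral0 P setT); apply: eq_integral => w _; rewrite mulr0.
have C0 : 0 <= C.
  have hh : 0 <= h <= h by rewrite lexx ltW.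
  by rewrite -lee_fin; apply: le_trans (ZC h hh); exact: ge0_sqint.
apply: (@le_trans _ _ (\int[mu]_(t in `[0%R, h]) C%:E)%E).
  rewrite [leRHS]integral_mkcond; apply: ge0_le_integral => //.
  - by move=> t _; apply: integral_ge0 => w _.
  - exact: (@measurable_fun_fubini_tonelli_G _ _ Omega (measurableTypeR R) R P f mf f0).
  - apply/(measurable_restrictT _ _).1 => //; exact: measurable_cst.
  - move=> t _; rewrite gE !patchE; case: ifPn => // tin.
    by apply: ZC; move: tin; rewrite inE/= in_itv.
rewrite integral_cst//= lebesgue_measure_itv/= lte_fin h0 -EFinB -EFinM.
by rewrite subr0.
Qed.

End random_elements.

(** * The inner product of H *)

Section inner_product.
Context {R : realType} (h : R).
Hypothesis h0 : 0 < h.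
Notation H := (spaceH h).
Implicit Types x y : H.

Lemma norm2_muH x : ((`|x| ^+ 2)%:E = \int[muH h]_t (L2rep x t ^+ 2)%:E)%E.
Proof.
rewrite normHE ge0_integral_muH//; last by move=> t; rewrite lee_fin sqr_ge0.
by apply/measurable_EFinP; apply: measurable_funX; exact: measurable_L2rep.
Qed.

Lemma Lfun_L2rep x : L2rep x \in Lfun (muH h) 2%:E.
Proof. exact: (LfunP (repr x : LfunType (muH h) (@lee1n R 2))). Qed.

(** The choice of representatives is not linear; it respects linear combinations almost everywhere
    only. *)
Lemma L2rep_scaleD (c : R) x y :
  {ae muH h, forall t, L2rep (x + c *: y) t = L2rep x t + c * L2rep y t}.
Proof.
pose F : LfunType (muH h) (@lee1n R 2) := repr x + c *: repr y.
have E : x + c *: y = L2pi F.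
  rewrite /F L2piD -L2scale_pi (L2reprK x).
  by congr (_ + _); rewrite -[LHS](_ : L2scale c y = _)// (L2reprK y).
suff : forall z : H, z = L2pi F ->
    {ae muH h, forall t, L2rep z t = L2rep x t + c * L2rep y t} by exact.
by move=> z ->; exact: L2repr_pi.
Qed.

Lemma norm2_scaleD (c : R) x y :
  `|x + c *: y| ^+ 2 = `|x| ^+ 2 + 2 * c * L2dot x y + c ^+ 2 * `|y| ^+ 2.
Proof.
have ix z := Lfun2_integrable_sqr (Lfun_L2rep z).
have ixy : (muH h).-integrable setT (EFin \o (fun t => L2rep x t * L2rep y t)).
  by apply/Lfun1_integrable; exact: (Lfun2_mul_Lfun1 (Lfun_L2rep x) (Lfun_L2rep y)).
have nE (z : H) : `|z| ^+ 2 = \int[muH h]_t (L2rep z t ^+ 2).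
  exact: (f_equal fine (norm2_muH z)).
have i1 : (muH h).-integrable setT (EFin \o (fun t => 2 * c * (L2rep x t * L2rep y t))).
  exact: (integrableZl _ (2 * c) ixy).
have i2 : (muH h).-integrable setT (EFin \o (fun t => c ^+ 2 * (L2rep y t ^+ 2))).
  exact: (integrableZl _ (c ^+ 2) (ix y)).
have i3 : (muH h).-integrable setT (EFin \o (fun t => L2rep x t ^+ 2 + 2 * c * (L2rep x t * L2rep y t))).
  exact: (integrableD _ (ix x) i1).
rewrite !nE /L2dot -!RintegralZl// -!RintegralD//.
rewrite /Rintegral; congr fine; apply: ae_eq_integral => //.
- exact: (measurable_int _ (ix _)).
- exact: (measurable_int _ (integrableD measurableT i3 i2)).
- have := L2rep_scaleD c x y; apply: filterS => t -> _.
  by congr EFin; ring.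
Qed.

(** Polarization rewrites an integral of representatives by norms, from which continuity of the
    inner product follows. *)
Lemma L2dot_polar x y : L2dot x y = 4^-1 * (`|x + y| ^+ 2 - `|x - y| ^+ 2).
Proof.
have := norm2_scaleD 1 x y; have := norm2_scaleD (-1) x y.
rewrite scale1r scaleN1r => -> ->; lra.
Qed.

Lemma continuous_L2dot y : continuous (fun x => L2dot x y).
Proof.
have sq (z : H) : continuous (fun x : H => `|x + z| ^+ 2).
  move=> x; have c1 : (fun u : H => u + z) u @[u --> x] --> x + z.
    have cid : (fun u : H => u) u @[u --> x] --> x by move=> A.
    exact: (cvgD cid (cvg_cst z)).
  have c2 := cvg_comp _ (fun v : H => `|v|) c1 (@norm_continuous R H (x + z)).
  exact: (cvg_comp _ (fun r : R => r ^+ 2) c2 (@sqr_continuous R _)).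
have -> : (fun x => L2dot x y) = (fun x : H => 4^-1 * (`|x + y| ^+ 2 - `|x - y| ^+ 2)).
  by apply/funext => x; exact: L2dot_polar.
move=> x; exact: (cvgM (cvg_cst (4^-1 : R)) (cvgB (sq y x) (sq (- y) x))).
Qed.

Lemma in_H_atom : in_H h (\1_[set h] : R -> R).
Proof.
apply: (in_H_bounded h0 (M := 1)).
  have m1 : measurable_fun setT (\1_[set h] : measurableTypeR R -> R).
    by apply: measurable_indic; exact: measurable_set1.
  by apply: measurable_funS m1.
by move=> t _; rewrite indicE; case: (_ \in _); rewrite ?normr0 ?normr1.
Qed.

Lemma muH_set1 : muH h [set h] = 1%E.
Proof.
rewrite /muH/= /measure_add/= /msum !big_ord_recr/= big_ord0 add0e.
rewrite diracE mem_set// /mrestr.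
rewrite (_ : [set h] `&` `[0, h] = [set h]) ?lebesgue_measure_set1 ?add0e//.
by apply/setIidPl => _ ->; rewrite /= in_itv/= lexx ltW.
Qed.

(** The indicator of {h} is Lebesgue-null but has mass 1 at the atom, hence represents evaluation at
    h. Through it, weak stationarity, which speaks of inner products, reaches the values at h. *)
Lemma L2dot_evalh x : L2dot x (toH h (\1_[set h] : R -> R)) = evalh x.
Proof.
have i1 : (muH h).-integrable setT (EFin \o (\1_[set h] : R -> R)).
  apply/integrableP; split.
    apply/measurable_EFinP.
    by apply: (@measurable_indic _ (measurableTypeR R)); exact: measurable_set1.
  under eq_integral do rewrite gee0_abs ?lee_fin//.
  by rewrite integral_indic//= setIT muH_set1 ltry.
transitivity (\int[muH h]_t (evalh x * (\1_[set h] : R -> R) t)).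
  rewrite /L2dot /Rintegral; congr fine; apply: ae_eq_integral => //.
  - apply/measurable_EFinP; apply: measurable_funM; exact: measurable_L2rep.
  - exact: (measurable_int _ (integrableZl measurableT (evalh x) i1)).
  - have := L2repr_pi (L2of h (\1_[set h] : R -> R)); rewrite -toH_pi.
    apply: filterS => t; rewrite L2ofE; last exact: in_H_atom.
    rewrite /L2rep => -> _; congr EFin.
    rewrite patchE indicE; case: ifPn => [_|th].
      have [->|/eqP th] := eqVneq t h; first by [].
      by rewrite memNset// !mulr0.
    rewrite memNset ?mulr0// => tE; move: th; rewrite tE.
    by rewrite (in_itv0h h0).
rewrite RintegralZl// /Rintegral integral_indic//= setIT.
by rewrite muH_set1 mulr1.
Qed.

End inner_product.

(** * Stationarity and tightness *)

Section stationarity.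
Context d (Omega : measurableType d) (R : realType) (P : probability Omega R).

(** Preimages of measurable sets of reals under continuous functionals are Borel in H, so
    stationarity in H gives equality of laws of real sequences. *)
Lemma same_law_functionals (H : normedModType R) (X : int -> Omega -> H)
    (g : nat -> H -> R) (n : nat -> int) (m : int) :
  (forall n, random_element (X n)) -> (forall j, continuous (g j)) ->
  strictly_stationary P X ->
  same_law P ((fun w j => g j (X (n j + m) w)) : Omega -> @pathspace R nat)
             ((fun w j => g j (X (n j) w)) : Omega -> @pathspace R nat).
Proof.
move=> rX cg sX; apply: same_law_cylinders.
- by apply: measurable_to_path => j; exact: measurable_continuous_comp.
- by apply: measurable_to_path => j; exact: measurable_continuous_comp.
move=> N i B mB.
pose C (j : 'I_N) : set H := g (i j) @^-1` B j.
have bC j : borel_set (C j) by apply: borel_set_preimage_open.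
have := sX N (fun j => n (i j)) m C bC.
have E k : \bigcap_j (X (n (i (nat_of_ord j)) + k) @^-1` C j) =
    [set w | forall j, (j < N)%N -> B j (g (i j) (X (n (i j) + k) w))].
  apply/seteqP; split => w /= H'.
    by move=> j jN; exact: (H' (Ordinal jN)).
  by move=> j _; exact: H'.
rewrite E => ->; have := E 0.
under eq_bigcapr do rewrite addr0.
move=> ->; congr (P _); apply/seteqP; split => w /= H' j jN; have := H' j jN; by rewrite addr0.
Qed.

Lemma covarianceE (X Y : Omega -> R) :
  covariance P X Y =
  (\int[P]_w ((X w - fine (\int[P]_w' (X w')%:E)) * (Y w - fine (\int[P]_w' (Y w')%:E)))%:E)%E.
Proof. by rewrite !unlock. Qed.

Lemma strictly_weakly_stationary d' (T : measurableType d')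
    (mu : {measure set T -> \bar R}) (X : int -> Omega -> L2space mu) :
  (forall x : L2space mu, continuous (fun y : L2space mu => L2dot y x)) ->
  (forall n, random_element (X n)) ->
  (forall n, \int[P]_w (`|X n w| ^+ 2)%:E < +oo)%E ->
  strictly_stationary P X -> weakly_stationary P X.
Proof.
move=> cdot rX X2 sX.
have Ex n m x : (\int[P]_w (L2dot (X (n + m) w) x)%:E = \int[P]_w (L2dot (X n w) x)%:E)%E.
  have sl := same_law_functionals (g := fun=> fun y => L2dot y x) (fun=> n) m rX
    (fun=> cdot x) sX.
  apply: (same_law_integral (F := fun z : @pathspace R nat => (z 0%N)%:E) _ sl).
  by apply/measurable_EFinP; exact: measurable_eval.
split => //.
- by move=> n m x; rewrite unlock; exact: Ex.
- move=> n n' m x y; rewrite !covarianceE !Ex.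
  set a := fine _; set b := fine _.
  (* Coordinate 0 carries the pair (n, x) and the others the pair (n', y); the covariance is the
     integral of a function of coordinates 0 and 1. *)
  have cg j : continuous (fun z => L2dot z (if j == 0%N then x else y) : R) by case: ifP.
  have sl := same_law_functionals (g := fun j z => L2dot z (if j == 0%N then x else y))
    (fun j => if j == 0%N then n else n') m rX cg sX.
  apply: (same_law_integral (F := fun z : @pathspace R nat => ((z 0%N - a) * (z 1%N - b))%:E) _ sl).
  by apply/measurable_EFinP; apply: measurable_funM; apply: measurable_funB => //; exact: measurable_eval.
Qed.

Context (h : R).
Hypothesis h0 : 0 < h.

(** Shifting the index by m translates the path by m h, and [toH_measurable] turns the events in H
    into events of the path space. *)
Lemma strictly_stationary_toH (Z : R -> Omega -> R) :
  (forall w, continuous (fun t => Z t w)) ->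
  (forall r, same_law P ((fun w t => Z t w) : Omega -> @pathspace R R)
                        ((fun w t => Z (t + r) w) : Omega -> @pathspace R R)) ->
  strictly_stationary P (fun (n : int) w => toH h (fun t => Z (n%:~R * h + t) w)).
Proof.
move=> cZ lawZ k n m B bB.
have /choice[C CP] : forall i : 'I_k, exists C : set (@pathspace R R), measurable C /\
    forall x : R -> R, continuous x -> (B i (toH h x) <-> C x).
  by move=> i; have [C mC HC] := toH_measurable h0 (bB i); exists C.
pose C' := \bigcap_(i in [set: 'I_k])
  [set x : @pathspace R R | C i (fun t => x ((n i)%:~R * h + t))].
have mC' : measurable C'.
  apply: fin_bigcap_measurable => // i _.
  have ms : measurable_fun setT
      ((fun x t => x ((n i)%:~R * h + t)) : @pathspace R R -> @pathspace R R).
    by apply: measurable_to_path => t; exact: measurable_eval.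
  by rewrite -[X in measurable X]setTI; apply: ms => //; exact: (CP i).1.
have cshift w s : continuous (fun t => Z (s + t) w).
  move=> t; apply: (@continuous_comp _ _ _ (fun t => s + t) (fun t => Z t w)); last exact: cZ.
  by apply: cvgD; [exact: cvg_cst|exact: cvg_id].
have [_ _ /(_ C' mC') lawC] := lawZ (m%:~R * h).
etransitivity; last (etransitivity; first exact: esym lawC).
- congr (P _); apply/seteqP; split => w /= H i _; have := H i I.
  + move=> /((CP i).2 _ (cshift w _)) /=; congr (C i _).
    by apply/funext => t; congr (Z _ w); rewrite intrD; ring.
  + move=> HC; apply/((CP i).2 _ (cshift w _)); move: HC; congr (C i _).
    by apply/funext => t; congr (Z _ w); rewrite intrD; ring.
- congr (P _); apply/seteqP; split => w /= H i _; have := H i I.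
  + by move=> HC; apply/((CP i).2 _ (cshift w _)).
  + by move=> /((CP i).2 _ (cshift w _)).
Qed.

End stationarity.

(** * Tight families of real random variables *)

Section tightness.
Context d (Omega : measurableType d) (R : realType) (P : probability Omega R).

Definition tight (I : Type) (U : I -> Omega -> R) : Prop :=
  forall e : R, 0 < e -> exists2 M : R, 0 < M &
    forall i, (P [set w | (M < `|U i w|)%R] <= e%:E)%E.

Lemma measurable_norm_gt (U : Omega -> R) (M : R) : measurable_fun setT U ->
  measurable [set w | M < `|U w|].
Proof.
move=> mU; have mN : measurable_fun setT (fun w => `|U w|) by exact: measurableT_comp.
have := mN measurableT `]M, +oo[%classic (measurable_itv _).
rewrite setTI; congr measurable; apply/seteqP.
by split => w /=; rewrite in_itv/= andbT.
Qed.

Lemma measurable_norm_gt_set (M : R) : measurable [set r : R | M < `|r|].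
Proof.
have mN : measurable_fun setT (fun r : R => `|r|) by exact: normr_measurable.
have := mN measurableT `]M, +oo[%classic (measurable_itv _).
rewrite setTI; congr measurable; apply/seteqP.
by split => w /=; rewrite in_itv/= andbT.
Qed.

Lemma tight_sqint (I : Type) (U : I -> Omega -> R) (S : R) :
  (forall i, measurable_fun setT (U i)) ->
  (forall i, \int[P]_w (U i w ^+ 2)%:E <= S%:E)%E -> tight U.
Proof.
move=> mU US e e0.
(* The threshold of Chebyshev's inequality; the added 1 keeps it positive when S = 0. *)
pose M := Num.sqrt ((`|S| + 1) / e).
have M0 : 0 < M by rewrite sqrtr_gt0 divr_gt0// ltr_wpDl.
exists M => // i; set A := [set w | _].
have mA : measurable A by exact: measurable_norm_gt.
have : ((M ^+ 2)%:E * P A <= S%:E)%E.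
  apply: le_trans (US i).
  rewrite -(setIT A) -integral_indic// -ge0_integralZl ?lee_fin ?sqr_ge0//; last first.
    by apply/measurable_EFinP; exact: measurable_indic.
  apply: ge0_le_integral => //.
  - by move=> w _; rewrite mule_ge0// lee_fin ?sqr_ge0.
  - by apply: emeasurable_funM => //; apply/measurable_EFinP; exact: measurable_indic.
  - exact: measurable_sqr.
  - move=> w _; rewrite indicE; case: (boolP (w \in A)) => [|_]; last by rewrite mule0 lee_fin sqr_ge0.
    rewrite inE /A/= mule1 lee_fin => Mw.
    by rewrite -[leRHS]real_normK ?num_real// lerXn2r// ?nnegrE// ltW.
rewrite sqr_sqrtr; last by rewrite divr_ge0 ?ltW// addr_ge0.
have PA : P A \is a fin_num by exact: fin_num_measure.
rewrite -(fineK PA) -EFinM !lee_fin => H.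
have : (`|S| + 1) / e * fine (P A) <= `|S| + 1.
  by apply: (le_trans H); rewrite ler_wpDr// ler_norm.
rewrite mulrAC ler_pdivrMr// ler_pM2l//; by rewrite ltr_wpDl.
Qed.

(** The events |U| > k + 1 decrease to the empty set, so their probabilities tend to 0. *)
Lemma tight_single (U : Omega -> R) : measurable_fun setT U ->
  forall e : R, 0 < e -> exists2 M : R, 0 < M & (P [set w | (M < `|U w|)%R] <= e%:E)%E.
Proof.
move=> mU e e0.
pose F k := [set w | k.+1%:R < `|U w|].
have mF k : measurable (F k) by exact: measurable_norm_gt.
have F0 : \bigcap_k F k = set0.
  apply/seteqP; split => // w /(_ (Num.truncn `|U w|) I).
  by rewrite /F/= ltNge ltW// truncnS_gt.
have : P (F k) @[k --> \oo] --> 0%E.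
  rewrite -(measure0 P) -F0; apply: nonincreasing_cvg_mu => //.
  - by rewrite (le_lt_trans (probability_le1 P (mF _)))// ltry.
  - by rewrite F0.
  - move=> a b ab; apply/subsetPset => w; rewrite /F/=; apply: le_lt_trans.
    by rewrite ler_nat.
move=> H; have [k _ /(_ k (leqnn k)) /ltW Hk] := cvge0_near_lt e0 H.
by exists k.+1%:R.
Qed.

Lemma tight_strictly_stationary (H : normedModType R) (Y : int -> Omega -> H) (g : H -> R) :
  (forall n, random_element (Y n)) -> continuous g -> strictly_stationary P Y ->
  tight (fun n w => g (Y n w)).
Proof.
move=> rY cg sY e e0.
have [M M0 HM] := tight_single (measurable_continuous_comp (rY 0) cg) e0.
exists M => // n; apply: le_trans HM; rewrite le_eqVlt; apply/orP; left; apply/eqP.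
pose B : set H := g @^-1` [set r | M < `|r|].
have bB : borel_set B.
  apply: borel_set_preimage_open => //.
  exact: measurable_norm_gt_set.
have := sY 1%N (fun=> 0) n (fun=> B) (fun=> bB).
have E m : \bigcap_(i in [set: 'I_1]) (Y m @^-1` B) = Y m @^-1` B.
  by apply: bigcap_const; exists ord0.
by rewrite !E add0r.
Qed.

(** If q > e then almost surely |U_k| > e / s_k for all k, and tightness makes these events
    arbitrarily improbable since e / s_k is unbounded. All events are built from U, because q will
    be the norm of a difference of random elements. *)
Lemma tight_squeeze (q : Omega -> R) (s : nat -> R) (U : nat -> Omega -> R) :
  (forall k, measurable_fun setT (U k)) -> tight U ->
  (forall k, 0 < s k) -> s k @[k --> \oo] --> 0 ->
  {ae P, forall w, forall k, q w <= s k * `|U k w|} ->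
  {ae P, forall w, q w <= 0}.
Proof.
move=> mU tU s0 cs dom.
have small (e : R) : 0 < e -> {ae P, forall w, q w <= e}.
  move=> e0.
  pose A := \bigcap_k [set w | e / s k < `|U k w|].
  have mA : measurable A by apply: bigcapT_measurable => k; exact: measurable_norm_gt.
  have PA0 : P A = 0%E.
    apply/eqP; rewrite eq_le measure_ge0 andbT; apply/lee_addgt0Pr => dl dl0.
    rewrite add0e; have [M M0 HM] := tU dl dl0.
    (* For this k the level e / s_k exceeds M, so A lies in the event |U_k| > M. *)
    have /cvgrPdist_lt /(_ (e / M) (divr_gt0 e0 M0)) [k _ /(_ k (leqnn k))] := cs.
    rewrite /= sub0r normrN gtr0_norm// => sk.
    apply: le_trans (HM k); apply: le_measure; rewrite ?inE//.
      exact: measurable_norm_gt.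
    move=> w /(_ k I) /=; apply: lt_trans.
    by rewrite ltr_pdivlMr// -ltr_pdivlMl// mulrC.
  have nA : {ae P, forall w, ~ A w} by exists A; split => // w /=; exact: contrapT.
  apply: filterS2 dom nA => w qw nAw; rewrite leNgt; apply/negP => eq.
  apply: nAw => k _ /=; rewrite ltr_pdivrMr// mulrC; exact: lt_le_trans (qw k).
have : {ae P, forall w, forall k, q w <= @harmonic R k}.
  by apply/ae_foralln => k; apply: small; rewrite /harmonic/= invr_gt0.
apply: filterS => w qk.
apply: (ler_cvg_to (cvg_cst (q w)) (@cvg_harmonic R)); exact: nearW.
Qed.

End tightness.

(** * The Ornstein-Uhlenbeck process *)

Lemma ae_forall_countable d (T : measurableType d) (R : realType)
    (mu : {measure set T -> \bar R}) (I : countType) (Q : I -> T -> Prop) :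
  (forall i, {ae mu, forall x, Q i x}) -> {ae mu, forall x, forall i, Q i x}.
Proof.
move=> HQ.
have : {ae mu, forall x, forall n, (if unpickle n is Some i then Q i x else True)}.
  apply/ae_foralln => n; case: (unpickle n) => [i|]; first exact: HQ.
  exact: aeW.
by apply: filterS => x H i; have := H (pickle i); rewrite pickleK.
Qed.

Section clamp.
Context {R : realType} (h : R).
Hypothesis h0 : 0 < h.

(** The innovations are continuous, and are Wiener integrals, for times in [0, h] only; composing
    with this retraction yields processes on the whole line with the same class in H. *)
Definition clamp (t : R) : R := Num.max 0 (Num.min t h).

Lemma clamp_itv t : 0 <= clamp t <= h.
Proof. by rewrite /clamp le_max lexx/= ge_max (ltW h0) ge_min lexx orbT. Qed.

Lemma clamp_id t : 0 <= t <= h -> clamp t = t.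
Proof. by move=> /andP[t0 th]; rewrite /clamp min_l// max_r. Qed.

Lemma continuous_clamp : continuous clamp.
Proof.
move=> t.
have c0 : {for t, continuous (fun=> 0 : R)} by exact: cvg_cst.
have ch : {for t, continuous (fun=> h : R)} by exact: cvg_cst.
have ci : {for t, continuous (fun s : R => s)} by move=> A.
exact: (continuous_max c0 (continuous_min ci ch)).
Qed.

Lemma continuous_comp_clamp (f : R -> R) : {within `[0, h], continuous f} ->
  continuous (fun t => f (clamp t)).
Proof.
move=> /subspace_continuousP cf t.
have ct : `[0, h]%classic (clamp t) by rewrite /= in_itv/= clamp_itv.
move=> V /(cf _ ct) fV.
have N : nbhs t [set s | `[0, h]%classic (clamp s) -> V (f (clamp s))].
  exact: (@continuous_clamp t _ fV).
apply: (filterS _ N) => s /= sV; apply: sV.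
by rewrite in_itv/= clamp_itv.
Qed.

End clamp.

Lemma continuous_shift (R : realType) (f : R -> R) (s : R) :
  continuous f -> continuous (fun t => f (s + t)).
Proof.
move=> cf t; apply: (@continuous_comp _ _ _ (fun t => s + t) f); last exact: cf.
by apply: cvgD; [exact: cvg_cst|exact: cvg_id].
Qed.

Lemma continuous_eq_rat (R : realType) (f g : R -> R) :
  continuous f -> continuous g -> (forall q : rat, f (ratr q) = g (ratr q)) ->
  forall t, f t = g t.
Proof.
move=> cf cg fg t; apply/eqP; apply: contrapT => /negP ne.
have cD : continuous (fun x => f x - g x) by move=> x; apply: cvgB; [exact: cf|exact: cg].
have oU : open [set x | f x - g x != 0].
  by move/continuousP : cD => cD; exact: (cD _ (@open_neq R 0)).
have U0 : [set x | f x - g x != 0] !=set0 by exists t => /=; rewrite subr_eq0.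
have [x [/= fx [q _ qx]]] := dense_rat U0 oU.
by move: fx; rewrite -qx fg subrr eqxx.
Qed.

Section ornstein_uhlenbeck_process.
Context d (Omega : measurableType d) (R : realType) (P : probability Omega R).
Context (W : R -> Omega -> R) (theta h : R).
Context (xi : R -> Omega -> R) (eps : int -> R -> Omega -> R).
Hypothesis h0 : 0 < h.
Hypotheses (BW : bilateral_wiener P W) (OU : ornstein_uhlenbeck P W theta xi).
Hypothesis IN : ou_innovation P W theta h eps.
Notation mu := (@lebesgue_measure R).
Notation H := (spaceH h).

Let cxi w : continuous (fun t => xi t w) := OU.2 w.

Lemma ou_measurable t : measurable_fun setT (xi t).
Proof. by have [] := OU.1 t. Qed.

Lemma ou_same_law r :
  same_law P ((fun w t => xi t w) : Omega -> @pathspace R R)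
             ((fun w t => xi (t + r) w) : Omega -> @pathspace R R).
Proof.
pose K (t s : R) : R := expR (- theta * (t - s)) * \1_(`]-oo, t]) s.
have Kxi t : wiener_integral P W (K t) (xi t) by exact: (OU.1 t).
apply: (stationary_wiener_integrals BW Kxi) => t x; rewrite /K.
rewrite (_ : t + r - x = t - (x - r)); last by ring.
congr (_ * _).
by rewrite !indicE; congr ((_ : bool)%:R); apply/idP/idP; rewrite !inE/= !in_itv/= lerBlDr.
Qed.

Definition ou_var : R := fine (\int[P]_w (xi 0 w ^+ 2)%:E).

(** Constancy in t is read off the invariance of the law rather than from the integral of the
    squared kernel. *)
Lemma ou_sqint t : (\int[P]_w (xi t w ^+ 2)%:E = ou_var%:E)%E.
Proof.
rewrite /ou_var fineK; last first.
  by rewrite ge0_fin_numE ?ge0_sqint//; exact: (wiener_integral_sqint_lty BW (OU.1 0)).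
have m0 : measurable_fun setT (fun x : @pathspace R R => (x 0 ^+ 2)%:E).
  by apply: measurable_sqr; exact: measurable_eval.
have pos0 (x : @pathspace R R) : (0 <= (x 0 ^+ 2)%:E)%E by rewrite lee_fin sqr_ge0.
have := same_law_ge0_integral m0 pos0 (ou_same_law t).
by rewrite add0r.
Qed.

Let Xn (n : int) (w : Omega) : H := toH h (fun t => xi (n%:~R * h + t) w).
Let En (n : int) (w : Omega) : H := toH h (fun t => eps n t w).

Lemma ou_path_continuous n w : continuous (fun t => xi (n%:~R * h + t) w).
Proof. exact: (@continuous_shift R (fun t => xi t w) (n%:~R * h) (@cxi w)). Qed.

Lemma in_H_ou n w : in_H h (fun t => xi (n%:~R * h + t) w).
Proof.
apply: in_H_continuous => //; apply: continuous_subspaceT.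
exact: (@ou_path_continuous n w).
Qed.

Lemma in_H_innovation n w : in_H h (fun t => eps n t w).
Proof. by apply: in_H_continuous => //; exact: ((IN n).2 w). Qed.

Lemma ou_recursion_at n t : 0 <= t <= h ->
  {ae P, forall w, xi (n%:~R * h + t) w = eps n t w + expR (- theta * t) * xi (n%:~R * h) w}.
Proof.
move=> th; have /andP[t0 _] := th.
have wi := wiener_integral_lincomb BW (expR (- theta * t)) ((IN n).1 t th) (OU.1 (n%:~R * h)).
apply: (wiener_integral_unique BW (OU.1 (n%:~R * h + t)) wi).
(* Both integrands on the right include the point s = n h, which is counted twice; the kernels agree
   everywhere else. *)
exists [set n%:~R * h]; split; [exact: measurable_set1|exact: lebesgue_measure_set1|].
move=> s /=; apply: contra_notP => /eqP sn.
rewrite (mulrA (expR (- theta * t))) -expRD.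
rewrite (_ : - theta * t + - theta * (n%:~R * h - s) = - theta * (n%:~R * h + t - s)); last by ring.
rewrite -mulrDr; congr (_ * _); rewrite !indicE !mem_setE !in_itv/=.
have [sn'|sn'|/eqP] := ltgtP s (n%:~R * h); last by rewrite (negbTE sn).
- by rewrite add0r (le_trans (ltW sn'))// lerDl.
- by rewrite addr0.
Qed.

Lemma ou_recursion :
  {ae P, forall w, forall n t, 0 <= t <= h ->
    xi (n%:~R * h + t) w = eps n t w + expR (- theta * t) * xi (n%:~R * h) w}.
Proof.
apply: ae_forall_countable => n.
(* Clamped rationals form a countable set of times in [0, h], and the clamped identity lives on the
   whole line, where density of the rationals applies. *)
have : {ae P, forall w, forall q : rat, let t := clamp h (ratr q) in
    xi (n%:~R * h + t) w = eps n t w + expR (- theta * t) * xi (n%:~R * h) w}.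
  by apply: ae_forall_countable => q; apply: ou_recursion_at; exact: clamp_itv.
apply: filterS => w Hw t th.
have := @continuous_eq_rat R
  (fun t => xi (n%:~R * h + clamp h t) w)
  (fun t => eps n (clamp h t) w + expR (- theta * clamp h t) * xi (n%:~R * h) w) _ _ Hw t.
rewrite clamp_id//; apply.
- move=> s; apply: (@continuous_comp _ _ _ (clamp h) (fun t => xi (n%:~R * h + t) w)).
    exact: continuous_clamp.
  exact: (@ou_path_continuous n w).
- move=> s; apply: cvgD.
    by apply: (@continuous_comp_clamp R h h0 (fun t => eps n t w)); exact: ((IN n).2 w).
  apply: cvgM; last exact: cvg_cst.
  apply: (@continuous_comp _ _ _ (fun t => - theta * clamp h t) expR); last exact: continuous_expR.
  by apply: cvgM; [exact: cvg_cst|exact: continuous_clamp].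
Qed.

Lemma evalh_ou n w : evalh (Xn n w) = xi (n%:~R * h + h) w.
Proof. exact: (evalh_toH (ltW h0) (in_H_ou n w)). Qed.

Lemma ou_autoregression :
  {ae P, forall w, forall n, Xn n w = rhoH theta (Xn (n - 1) w) + En n w}.
Proof.
apply: filterS ou_recursion => w Hw n.
rewrite rhoHE// evalh_ou /rho_vec -toHZ//; last exact: in_H_expR.
rewrite -toHD//; [|by apply: in_HZ; exact: in_H_expR|exact: in_H_innovation].
apply: eq_toH => t th; rewrite Hw// addrC; congr (_ + _); rewrite mulrC; congr (xi _ w * _).
by rewrite intrD; ring.
Qed.

Lemma random_element_ou n : random_element (Xn n).
Proof.
apply: (random_element_toH h0 (Z := fun t w => xi (n%:~R * h + t) w)) => [t|w].
  exact: ou_measurable.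
exact: ou_path_continuous.
Qed.

Lemma autoregressive_ou : autoregressive P (rhoH theta) En Xn.
Proof.
split=> [n|n]; first exact: random_element_ou.
by apply: filterS ou_autoregression => w ->.
Qed.

Lemma strictly_stationary_ou : strictly_stationary P Xn.
Proof. exact: (strictly_stationary_toH h0 cxi ou_same_law). Qed.

Lemma weakly_stationary_ou : weakly_stationary P Xn.
Proof.
apply: strictly_weakly_stationary.
- by move=> x; exact: continuous_L2dot.
- exact: random_element_ou.
- move=> n; apply: (@le_lt_trans _ _ (ou_var * h + ou_var)%:E); last exact: ltry.
  apply: (sqint_norm_toH_le h0 (Z := fun t w => xi (n%:~R * h + t) w)) => [t|w|t _].
  + exact: ou_measurable.
  + exact: ou_path_continuous.
  + by rewrite ou_sqint.
- exact: strictly_stationary_ou.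
Qed.

End ornstein_uhlenbeck_process.

(** * Iteration of the equation and tightness of the values at h *)

Section autoregression_unfolding.
Context {R : realType} {H : normedModType R} (rho : H -> H).
Hypothesis rhoD : {morph rho : x y / x + y}.

Lemma iterD k : {morph iter k rho : x y / x + y}.
Proof. by elim: k => [|k IH] x y //; rewrite !iterS IH rhoD. Qed.

Lemma iter_morph0 k : iter k rho 0 = 0.
Proof.
elim: k => [|k IH] //; rewrite iterS IH.
by apply: (addrI (rho 0)); rewrite -rhoD !addr0.
Qed.

Lemma autoregression_unfold (Y e : int -> H) (N : nat) (n : int) :
  (forall n, Y n = rho (Y (n - 1)) + e n) ->
  Y n = \sum_(k < N) iter k rho (e (n - k%:Z)) + iter N rho (Y (n - N%:Z)).
Proof.
move=> AR; elim: N => [|N IH]; first by rewrite big_ord0 add0r subr0.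
rewrite big_ord_recr/= {1}IH -addrA; congr (_ + _).
rewrite {1}AR iterD [LHS]addrC -[rho (iter N rho _)]iterS iterSr.
congr (_ + iter N rho (rho (Y _))).
by rewrite -addn1 PoszD opprD addrA.
Qed.

End autoregression_unfolding.

Section tightness_of_boundary_values.
Context d (Omega : measurableType d) (R : realType) (P : probability Omega R).
Context (h : R) (h0 : 0 < h).
Notation H := (spaceH h).

Lemma continuous_evalh : continuous (@evalh R h).
Proof.
have -> : @evalh R h = fun x => L2dot x (toH h (\1_[set h] : R -> R)).
  by apply/funext => x; rewrite L2dot_evalh.
exact: continuous_L2dot.
Qed.

(** Finiteness of each second moment is not uniform in n; a uniform bound 2 v + 2 a^2 comes from the
    common mean a and variance v of the values at h. *)
Lemma tight_evalh_weakly_stationary (Y : int -> Omega -> H) :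
  (forall n, random_element (Y n)) -> weakly_stationary P Y ->
  tight P (fun n w => evalh (Y n w)).
Proof.
move=> rY [Y2 YE YV]; pose e : H := toH h (\1_[set h] : R -> R).
have UE n w : L2dot (Y n w) e = evalh (Y n w) := L2dot_evalh h0 (Y n w).
pose U n w := evalh (Y n w).
have mU n : measurable_fun setT (U n).
  exact: (measurable_continuous_comp (rY n) continuous_evalh).
pose a := fine (\int[P]_w (U 0 w)%:E)%E.
have aE n : fine (\int[P]_w (U n w)%:E)%E = a.
  have := YE 0 n e; rewrite !unlock add0r /a.
  by under eq_integral do rewrite UE; under [in RHS]eq_integral do rewrite UE; move=> ->.
have VE n : (\int[P]_w ((U n w - a) ^+ 2)%:E = \int[P]_w ((U 0 w - a) ^+ 2)%:E)%E.
  have := YV 0 0 n e e; rewrite !covarianceE !add0r.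
  have FE m : fine (\int[P]_w (L2dot (Y m w) e)%:E)%E = a.
    by under eq_integral do rewrite UE; exact: aE.
  rewrite !FE.
  under eq_integral do rewrite UE -expr2.
  by under [in RHS]eq_integral do rewrite UE -expr2.
have U02 : (\int[P]_w (U 0 w ^+ 2)%:E < +oo)%E.
  apply: le_lt_trans (Y2 0); apply: ge0_le_integral => //.
  - by move=> w _; rewrite lee_fin sqr_ge0.
  - by apply: measurable_sqr; exact: mU.
  - apply: (measurable_sqr (f := fun w => `|Y 0 w|)).
    by apply: measurable_continuous_comp; [exact: rY|exact: norm_continuous].
  - move=> w _; rewrite lee_fin -[leLHS]real_normK ?num_real//.
    by rewrite lerXn2r// ?nnegrE// evalh_norm.
have cst2 (b : R) : (\int[P]_w (b ^+ 2)%:E = (b ^+ 2)%:E)%E.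
  rewrite integral_cst// -[RHS]mule1; congr (_ * _)%E.
  exact: probability_setT.
have V0 : (\int[P]_w ((U 0 w - a) ^+ 2)%:E < +oo)%E.
  apply: le_lt_trans (sqintD_le P (mU 0) (measurable_cst (- a))) _.
  rewrite cst2; apply: lte_add_pinfty; last by rewrite -EFinM ltry.
  by rewrite lte_mul_pinfty ?lee_fin.
pose v := fine (\int[P]_w ((U 0 w - a) ^+ 2)%:E)%E.
apply: (tight_sqint (S := 2 * v + 2 * a ^+ 2)) => // n.
have mUa : measurable_fun setT (fun w => U n w - a) by exact: measurable_funB.
have vfin : (\int[P]_w ((U 0 w - a) ^+ 2)%:E)%E \is a fin_num.
  by rewrite ge0_fin_numE// ge0_sqint.
have := sqintD_le P mUa (measurable_cst a).
rewrite /= cst2 VE -{1}(fineK vfin) -/v -!EFinM -EFinD.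
by under eq_integral do rewrite subrK.
Qed.

Lemma tight_normD (I : Type) (U V : I -> Omega -> R) :
  (forall i, measurable_fun setT (U i)) -> (forall i, measurable_fun setT (V i)) ->
  tight P U -> tight P V -> tight P (fun i w => `|U i w| + `|V i w|).
Proof.
move=> mU mV tU tV e e0.
have e20 : 0 < e / 2 by rewrite divr_gt0.
have [M M0 HM] := tU _ e20; have [M' M'0 HM'] := tV _ e20.
exists (M + M'); first by rewrite addr_gt0.
move=> i; rewrite (splitr e) EFinD.
apply: (@le_trans _ _ (P [set w | (M < `|U i w|)%R] + P [set w | (M' < `|V i w|)%R])%E); last first.
  exact: leeD (HM i) (HM' i).
have mA := measurable_norm_gt M (mU i); have mB := measurable_norm_gt M' (mV i).
apply: (@le_trans _ _ (P ([set w | (M < `|U i w|)%R] `|` [set w | (M' < `|V i w|)%R]))%E); last first.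
  exact: measureU2.
apply: le_measure; rewrite ?inE.
- apply: measurable_norm_gt; apply: measurable_funD; exact: measurableT_comp.
- exact: measurableU.
- move=> w /=; rewrite ger0_norm ?addr_ge0// => MM.
  have [|UM] := ltP M `|U i w|; first by left.
  right; rewrite ltNge; apply/negP => VM; move: MM.
  by rewrite ltNge lerD.
Qed.

End tightness_of_boundary_values.

(** * Uniqueness and the moving average representation *)

Section moving_average.
Context d (Omega : measurableType d) (R : realType) (P : probability Omega R).
Context (W : R -> Omega -> R) (theta h : R).
Context (xi : R -> Omega -> R) (eps : int -> R -> Omega -> R).
Hypotheses (theta0 : 0 < theta) (h0 : 0 < h).
Hypotheses (BW : bilateral_wiener P W) (OU : ornstein_uhlenbeck P W theta xi).
Hypothesis IN : ou_innovation P W theta h eps.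
Notation H := (spaceH h).

Let Xn (n : int) (w : Omega) : H := toH h (fun t => xi (n%:~R * h + t) w).
Let En (n : int) (w : Omega) : H := toH h (fun t => eps n t w).
Let rho : H -> H := rhoH theta.
Let r : R := expR (- theta * h).
Let v : H := rho_vec h theta.

Let r01 : 0 < r < 1.
Proof. by rewrite expR_gt0 -expR0 ltr_expR mulNr oppr_lt0 mulr_gt0. Qed.

Let r201 : 0 < r ^+ 2 < 1.
Proof.
have /andP[r0 r1] := r01.
by rewrite exprn_gt0//= expr_lt1// ltW.
Qed.

Lemma rhoHD : {morph rho : x y / x + y}.
Proof. by move=> x y; rewrite /rho !rhoHE// evalhD scalerDl. Qed.

Lemma autoregressive_unfold (Y : int -> Omega -> H) : autoregressive P rho En Y ->
  {ae P, forall w, forall n, Y n w = rho (Y (n - 1) w) + En n w}.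
Proof. by move=> [_ AR]; exact: ae_forall_countable. Qed.

Lemma ou_unique (Y : int -> Omega -> H) : autoregressive P rho En Y ->
  strictly_stationary P Y \/ weakly_stationary P Y ->
  forall n, {ae P, forall w, Y n w = Xn n w}.
Proof.
move=> ARY statY n; have [rY _] := ARY.
have rX m : random_element (Xn m) := random_element_ou (theta := theta) h0 OU m.
have mev (Z : int -> Omega -> H) m : (forall m, random_element (Z m)) ->
    measurable_fun setT (fun w => evalh (Z m w)).
  by move=> rZ; exact: (measurable_continuous_comp (rZ m) (continuous_evalh h0)).
have tY : tight P (fun n w => evalh (Y n w)).
  case: statY => [sY|wY]; last exact: tight_evalh_weakly_stationary.
  exact: (tight_strictly_stationary rY (continuous_evalh h0) sY).
have tX : tight P (fun n w => evalh (Xn n w)).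
  exact: (tight_strictly_stationary rX (continuous_evalh h0)
    (strictly_stationary_ou h0 BW OU)).
pose U k w := `|evalh (Y (n - k.+1%:Z) w)| + `|evalh (Xn (n - k.+1%:Z) w)|.
(* The power is k for the value at time n - (k + 1), as the first application of [rho] to that state
   only reads its value at h. The added 1 ensures positivity without showing v to be nonzero. *)
pose s k := (`|v| + 1) * r ^+ k.
have /andP[r0 r1] := r01.
have tU : tight P U.
  move=> e e0; have [M M0 HM] := tight_normD (fun i => mev Y i rY) (fun i => mev Xn i rX) tY tX e0.
  by exists M => // k; exact: HM.
have : {ae P, forall w, `|Y n w - Xn n w| <= 0}.
  apply: (tight_squeeze (s := s) (U := U)) => //.
  - move=> k; apply: measurable_funD; apply: measurableT_comp => //; exact: mev.
  - by move=> k; rewrite mulr_gt0 ?exprn_gt0// ltr_wpDl.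
  - by apply: (@cvg_geometric R (`|v| + 1) r); rewrite gtr0_norm.
  have := ou_autoregression h0 BW OU IN.
  have := autoregressive_unfold ARY.
  apply: filterS2 => w HY HX k.
  (* The difference solves the equation with zero innovations, so that unfolding leaves the
     remainder alone. *)
  have HD m : Y m w - Xn m w = rho (Y (m - 1) w - Xn (m - 1) w) + 0.
    rewrite addr0 {1}HY {1}[Xn m w]HX opprD addrACA subrr addr0.
    rewrite /rho !rhoHE// -scalerBl; congr (_ *: _).
    by rewrite evalhB.
  have := @autoregression_unfold R H rho rhoHD (fun m => Y m w - Xn m w) (fun=> 0) k.+1 n HD.
  rewrite big1 ?add0r; last by move=> i _; exact: (iter_morph0 rhoHD).
  move=> ->; rewrite iter_rhoH// normrZ normrM normrX (gtr0_norm r0) -/v.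
  rewrite (mulrC _ `|v|) mulrCA /s (mulrC (`|v| + 1)) -(mulrA _ (`|v| + 1)).
  rewrite ler_pM2l ?exprn_gt0//.
  apply: ler_pM => //; first by rewrite lerDl.
  rewrite evalhB [leRHS]ger0_norm; last by rewrite /U addr_ge0.
  exact: ler_normB.
by apply: filterS => w; rewrite normr_le0 subr_eq0 => /eqP.
Qed.

Lemma ou_remainder : {ae P, forall w, forall (n : int) (k : nat),
  Xn n w - MAH_sum rho En n k.+1 w = (r ^+ k * xi ((n - k.+1%:Z)%:~R * h + h) w) *: v}.
Proof.
have := ou_autoregression h0 BW OU IN; apply: filterS => w HX n k.
rewrite {1}(@autoregression_unfold R H rho rhoHD (Xn ^~ w) (En ^~ w) k.+1 n HX).
rewrite addrAC subrr add0r iter_rhoH//; congr ((_ * _) *: _).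
exact: (evalh_ou h0 OU).
Qed.

Lemma MAH_sum_path (n : int) (N : nat) : exists G : R -> Omega -> R,
  [/\ forall t, measurable_fun setT (G t), forall w, continuous (fun t => G t w) &
      forall w, MAH_sum rho En n N w = toH h (fun t => G t w)].
Proof.
have meps m t : measurable_fun setT (eps m (clamp h t)).
  by have [] := (IN m).1 (clamp h t) (clamp_itv h0 t).
have ceps m w : continuous (fun t => eps m (clamp h t) w).
  exact: (@continuous_comp_clamp R h h0 (fun t => eps m t w) ((IN m).2 w)).
have cH (f : R -> R) : continuous f -> in_H h f.
  by move=> cf; apply: in_H_continuous => //; exact: continuous_subspaceT.
have Eeps m w : En m w = toH h (fun t => eps m (clamp h t) w).
  by apply: eq_toH => t th; rewrite clamp_id.
elim: N => [|N [G [mG cG GE]]].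
  exists (fun=> fun=> 0); split => [t|w|w]; first exact: measurable_cst.
    by move=> t; exact: cvg_cst.
  rewrite /MAH_sum big_ord0 -[0 in LHS](scale0r (toH h (cst 0 : R -> R))) -toHZ//.
    by congr toH; apply/funext => t; rewrite mul0r.
  by apply: cH => t; exact: cvg_cst.
have [g [mg cg gE]] : exists g : R -> Omega -> R,
  [/\ forall t, measurable_fun setT (g t), forall w, continuous (fun t => g t w) &
      forall w, iter N rho (En (n - N%:Z) w) = toH h (fun t => g t w)].
  (* The term of index 0 is an innovation itself, whereas every later term is a random multiple of t
     |-> exp (- theta t). *)
  case: N {G mG cG GE} => [|k].
    by exists (fun t => eps (n - 0%:Z) (clamp h t)); split => // w; exact: Eeps.
  exists (fun t w => r ^+ k * eps (n - k.+1%:Z) (clamp h h) w * expR (- theta * t)); split.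
  - by move=> t; apply: measurable_funM => //; apply: measurable_funM.
  - move=> w t; apply: cvgM; first exact: cvg_cst.
    apply: (@continuous_comp _ _ _ (fun t => - theta * t) expR); last exact: continuous_expR.
    by apply: cvgM; [exact: cvg_cst|exact: cvg_id].
  - move=> w; rewrite /rho iter_rhoH// toHZ; last exact: in_H_expR.
    congr ((_ * _) *: _); rewrite Eeps; exact: (evalh_toH (ltW h0) (cH _ (@ceps _ w))).
exists (fun t w => G t w + g t w); split => [t|w t|w].
- exact: measurable_funD.
- by apply: cvgD; [exact: cG|exact: cg].
- by rewrite /MAH_sum big_ord_recr/= toHD ?gE -?GE//; apply: cH; [exact: cG|exact: cg].
Qed.

Lemma measurable_remainder (n : int) (N : nat) :
  measurable_fun setT (fun w => `|Xn n w - MAH_sum rho En n N w|).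
Proof.
have [G [mG cG GE]] := MAH_sum_path n N.
have cX w : continuous (fun t => xi (n%:~R * h + t) w) :=
  @continuous_shift R (fun t => xi t w) (n%:~R * h) (OU.2 w).
have cH (f : R -> R) : continuous f -> in_H h f.
  by move=> cf; apply: in_H_continuous => //; exact: continuous_subspaceT.
have rE : random_element (fun w => toH h (fun t => xi (n%:~R * h + t) w - G t w)).
  apply: (random_element_toH h0 (Z := fun t w => xi (n%:~R * h + t) w - G t w)) => [t|w t].
  - by apply: measurable_funB => //; exact: (ou_measurable OU).
  - by apply: cvgB; [exact: cX|exact: cG].
have := measurable_continuous_comp rE (@norm_continuous R H).
congr measurable_fun; apply/funext => w.
by rewrite GE /Xn -toHB//; apply: cH; [exact: cX|exact: cG].
Qed.

Lemma ou_MAH_representation : MAH_representation P rho En Xn.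
Proof.
move=> n; have /andP[r0 r1] := r01; have /andP[r20 r21] := r201.
pose V k w := r ^+ k * xi ((n - k.+1%:Z)%:~R * h + h) w.
have mV k : measurable_fun setT (V k).
  by apply: measurable_funM => //; exact: (ou_measurable OU).
have V2 k : (\int[P]_w (V k w ^+ 2)%:E = (ou_var P xi * (r ^+ 2) ^+ k)%:E)%E.
  rewrite sqintZ; last exact: (ou_measurable OU).
  by rewrite (ou_sqint BW OU) -EFinM mulrC -!exprM mulnC.
have ov0 : 0 <= ou_var P xi by rewrite -lee_fin -(ou_sqint BW OU 0); exact: ge0_sqint.
split.
  have V0 : {ae P, forall w, V k w @[k --> \oo] --> 0}.
    apply: ae_cvg_summable => //.
    apply: (nneseries_geometric_lty ov0 r201) => k; first exact: ge0_sqint.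
    by rewrite V2.
  have := ou_remainder; apply: filterS2 V0 => w V0 HX.
  (* The remainder is a multiple of v once [rho] has been applied at least once, hence the shift
     past the empty sum. *)
  rewrite -cvg_shiftS.
  have -> : (fun N => MAH_sum rho En n N.+1 w) = (fun k => Xn n w - V k w *: v).
    by apply/funext => k; rewrite /V -HX opprB addrC subrK.
  have E0 : Xn n w - 0 *: v = Xn n w by rewrite scale0r subr0.
  have c : (fun k => Xn n w - V k w *: v) k @[k --> \oo] --> Xn n w - 0 *: v.
    exact: (cvgB (cvg_cst (Xn n w)) (cvgZ V0 (cvg_cst v))).
  by rewrite E0 in c.
rewrite -cvg_shiftS.
have -> : (fun N => \int[P]_w (`|Xn n w - MAH_sum rho En n N.+1 w| ^+ 2)%:E)%E =
    (fun k => (geometric (`|v| ^+ 2 * ou_var P xi) (r ^+ 2) k)%:E).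
  apply/funext => k; rewrite /geometric /= -mulrA EFinM -V2.
  have V20 w : [set: Omega] w -> (0 <= (V k w ^+ 2)%:E)%E by rewrite lee_fin sqr_ge0.
  have v20 : (0 <= (`|v| ^+ 2)%:E)%E by rewrite lee_fin sqr_ge0.
  rewrite -(ge0_integralZl P measurableT (measurable_sqr (mV k)) V20 v20).
  apply: ae_eq_integral => //.
  - exact: (measurable_sqr (measurable_remainder n k.+1)).
  - by apply: emeasurable_funM => //; exact: (measurable_sqr (mV k)).
  - have := ou_remainder; apply: filterS => w HX _.
    by rewrite HX -EFinM normrZ exprMn real_normK ?num_real// mulrC.
apply: cvg_EFin; first exact: nearW.
by apply: cvg_geometric; rewrite gtr0_norm.
Qed.

End moving_average.

Theorem mainTheorem5 (R : realType) (d : measure_display)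
    (Omega : measurableType d) (P : probability Omega R)
    (W : R -> Omega -> R) (theta h : R)
    (xi : R -> Omega -> R) (eps : int -> R -> Omega -> R) :
  0 < theta -> 0 < h ->
  bilateral_wiener P W ->
  ornstein_uhlenbeck P W theta xi ->
  ou_innovation P W theta h eps ->
  let Xpath (n : int) (w : Omega) (t : R) : R := xi (n%:~R * h + t) w in
  let epspath (n : int) (w : Omega) (t : R) : R := eps n t w in
  let X (n : int) (w : Omega) : spaceH h := toH h (Xpath n w) in
  let epsH (n : int) (w : Omega) : spaceH h := toH h (epspath n w) in
  let rho : spaceH h -> spaceH h := rhoH theta in
  [/\ (forall n w, in_H h (Xpath n w) /\ in_H h (epspath n w)),
      bounded_operator rho,
      [/\ autoregressive P rho epsH X,
          strictly_stationary P X & weakly_stationary P X],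
      (forall Y : int -> Omega -> spaceH h,
         autoregressive P rho epsH Y ->
         strictly_stationary P Y \/ weakly_stationary P Y ->
         forall n, {ae P, forall w, Y n w = X n w}) &
      MAH_representation P rho epsH X].
Proof.
move=> theta0 h0 BW OU IN Xpath epspath X epsH rho; split.
- by move=> n w; split; [exact: (in_H_ou h0 OU)|exact: (in_H_innovation h0 IN)].
- exact: bounded_rhoH.
- split.
  + exact: (autoregressive_ou h0 BW OU IN).
  + exact: (strictly_stationary_ou h0 BW OU).
  + exact: (weakly_stationary_ou h0 BW OU).
- exact: (ou_unique theta0 h0 BW OU IN).
- exact: (ou_MAH_representation theta0 h0 BW OU IN).
Qed.
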